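(* For any prime power $q$, there exists an $n$-vector harmonic equiangular tight frame (ETF) for $\mathbb{C}^d$ that is a disjoint union of $v$ regular $s$-simplices whenever one of the following holds: (a) $d=q^{2f-1}$, $n=\frac{q^{2f}-1}{q-1}$, $v=\frac{q^f-1}{q-1}$ and $s=q^f$, where $f\geq2$ is an integer; (b) $d=q^e\left(\frac{q^{e+1}-1}{q-1}\right)$, $n=q^{e+1}\left(1+\frac{q^{e+1}-1}{q-1}\right)$, $v=q^{e+1}$ and $s=\frac{q^{e+1}-1}{q-1}$, where $e\geq1$ is an integer; (c) $d=\frac12(q+1)^2$, $n=q(q+2)$, $v=q$ and $s=q+1$, provided $q+2$ is an odd prime power.
   Context: A subset $\mathcal{D}$ of a finite abelian group $\mathcal{G}$ (written additively) is a difference set if $\#\{(d,d')\in\mathcal{D}\times\mathcal{D}: g=d-d'\}$ is constant over all $g\in\mathcal{G}$, $g\neq0$. Let $\Gamma$ be the Pontryagin dual of $\mathcal{G}$, i.e. the group of all homomorphisms $\gamma:\mathcal{G}\to\{z\in\mathbb{C}:|z|=1\}$. A harmonic ETF is the sequence $\{\varphi_\gamma\}_{\gamma\in\Gamma}$ in $\mathbb{C}^{\mathcal{D}}\cong\mathbb{C}^{d}$, $d=\#\mathcal{D}$, given by $\varphi_\gamma(g)=\gamma(g)$ for $g\in\mathcal{D}$, where $\mathcal{D}$ is a difference set in a finite abelian group $\mathcal{G}$; it has $n=\#\mathcal{G}$ vectors and is known to be an ETF for $\mathbb{C}^{\mathcal{D}}$. A finite sequence of nonzero vectors $\{\varphi_l\}$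 in a Hilbert space $\mathbb{H}$ is an ETF for $\mathbb{H}$ if all vectors have equal norm, $|\langle\varphi_l,\varphi_{l'}\rangle|$ is constant over all $l\neq l'$, and there is $a>0$ such that $\sum_{l}\langle\varphi_l,y\rangle\varphi_l=ay$ for all $y\in\mathbb{H}$ (inner products are conjugate-linear in the first argument). For a positive integer $s$, a regular $s$-simplex is a sequence of $s+1$ vectors that is an ETF for its span, where this span has dimension $s$. An ETF is a disjoint union of $v$ regular $s$-simplices if its index set can be partitioned into $v$ subsets $\mathcal{K}_1,\dots,\mathcal{K}_v$ such that, for each $i$, the vectors indexed by $\mathcal{K}_i$ form a regular $s$-simplex. *)

(* Defs.v *)
From HB Require Import structures.
From mathcomp Require Import all_boot all_order all_algebra.
From mathcomp Require Import reals complex.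

Set Implicit Arguments.
Unset Strict Implicit.
Unset Printing Implicit Defensive.

Import Order.TTheory GRing.Theory Num.Theory.
Local Open Scope ring_scope.

Definition prime_power (q : nat) : Prop :=
  exists p k : nat, [/\ prime p, (0 < k)%N & q = (p ^ k)%N].

Definition difference_set (G : finZmodType) (D : {set G}) : Prop :=
  exists lambda : nat, forall g : G, g != 0 ->
    #|[set p in setX D D | g == p.1 - p.2]| = lambda.

Definition is_unitary_char (G : finZmodType) (C : numClosedFieldType)
    (u : {ffun G -> C}) : bool :=
  [forall x, `|u x| == 1] && [forall x, forall y, u (x + y) == u x * u y].

Record pontryagin_dual (G : finZmodType) (C : numClosedFieldType) :=
  PontryaginDual {
    dual_val :> {ffun G -> C};
    _ : is_unitary_char dual_val
  }.

HB.instance Definition _ G C := [isSub for @dual_val G C].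
HB.instance Definition _ G C := [Choice of pontryagin_dual G C by <:].

(* A character takes its values among the #|G|-th roots of unity, which makes  *)
(* the dual a finite type.                                                    *)
Section DualFinite.
Variables (G : finZmodType) (C : numClosedFieldType).
Implicit Type u : pontryagin_dual G C.

Definition unity_roots : seq C :=
  sval (closed_field_poly_normal ('X^#|G| - 1 : {poly C})).

Lemma dualD u x y : u (x + y) = u x * u y.
Proof. by case: u => u /= /andP[_ /forallP/(_ x)/forallP/(_ y)/eqP]. Qed.

Lemma dual_norm u x : `|u x| = 1.
Proof. by case: u => u /= /andP[/forallP/(_ x)/eqP]. Qed.

Lemma dual_unity_root u x : u x \in unity_roots.
Proof.
have G_gt0 : (0 < #|{: G}|)%N by apply/card_gt0P; exists 0.
have uG : u x ^+ #|G| = 1.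
  have prod_neq0 : \prod_(y : G) u y != 0.
    by apply/prodf_neq0 => y _; rewrite -normr_eq0 dual_norm oner_eq0.
  have : \prod_(y : G) u (x + y) = u x ^+ #|G| * \prod_(y : G) u y.
    by under eq_bigr do rewrite dualD; rewrite big_split prodr_const.
  have <- : \prod_(y : G) u y = \prod_(y : G) u (x + y).
    by rewrite [LHS](reindex_inj (addrI x)).
  by rewrite -[LHS]mul1r => /(mulIf prod_neq0).
rewrite /unity_roots; case: closed_field_poly_normal => s /= def_s.
have : root ('X^#|G| - 1) (u x) by rewrite rootE !hornerE uG subrr.
by rewrite def_s lead_coefXnsubC // scale1r root_prod_XsubC.
Qed.

Definition dual_code u : {ffun G -> 'I_(size unity_roots).+1} :=
  [ffun x => inord (index (u x) unity_roots)].

Definition dual_decode (c : {ffun G -> 'I_(size unity_roots).+1}) :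
    option (pontryagin_dual G C) :=
  insub [ffun x => unity_roots`_(c x)].

Lemma dual_codeK : pcancel dual_code dual_decode.
Proof.
move=> u; rewrite /dual_decode.
have -> : [ffun x => unity_roots`_(dual_code u x)] = val u.
  apply/ffunP=> x; rewrite !ffunE inordK ?ltnS ?index_size //.
  by rewrite nth_index // dual_unity_root.
exact: valK.
Qed.

HB.instance Definition _ := PCanIsCountable dual_codeK.
HB.instance Definition _ : isFinite (pontryagin_dual G C) :=
  PCanIsFinite dual_codeK.
End DualFinite.

(* C^T for a finite set T. The alias C^o only serves to provide the canonical  *)
(* vector space structure.                                                    *)
Notation cvec C T := {ffun T -> C^o}.

Definition inner (C : numClosedFieldType) (T : finType) (x y : cvec C T) : C :=
  \sum_(t : T) (x t : C)^* * (y t : C).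

Definition hnorm (C : numClosedFieldType) (T : finType) (x : cvec C T) : C :=
  sqrtC (inner x x).

(* The Hilbert space is a subspace U of C^T, with the induced inner product.   *)
Definition is_etf (C : numClosedFieldType) (T I : finType)
    (U : {vspace cvec C T}) (phi : I -> cvec C T) : Prop :=
  [/\ forall l, phi l \in U /\ phi l != 0,
      forall l l', hnorm (phi l) = hnorm (phi l'),
      exists c : C, forall l l', l != l' -> `|inner (phi l) (phi l')| = c
    & exists a : C, 0 < a /\
        forall y, y \in U -> \sum_(l : I) inner (phi l) y *: phi l = a *: y].

Definition family_span (C : numClosedFieldType) (T I : finType)
    (phi : I -> cvec C T) : {vspace cvec C T} := <<codom phi>>%VS.

Definition regular_simplex (C : numClosedFieldType) (T I : finType) (s : nat)
    (phi : I -> cvec C T) : Prop :=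
  [/\ (0 < s)%N, #|I| = s.+1, is_etf (family_span phi) phi
    & \dim (family_span phi) = s].

Definition subfamily (C : numClosedFieldType) (T I : finType)
    (phi : I -> cvec C T) (K : {set I}) : {l : I | l \in K} -> cvec C T :=
  fun l => phi (val l).
Arguments subfamily {C T I} phi K _.

Definition disjoint_union_of_simplices (C : numClosedFieldType)
    (T I : finType) (v s : nat) (phi : I -> cvec C T) : Prop :=
  exists P : {set {set I}},
    [/\ partition P [set: I], #|P| = v
      & forall K : {set I}, K \in P -> regular_simplex s (subfamily phi K)].

Definition harmonic (G : finZmodType) (C : numClosedFieldType) (D : {set G}) :
    pontryagin_dual G C -> cvec C {g : G | g \in D} :=
  fun u => [ffun g => u (val g)].
Arguments harmonic {G} C D _.

(* Main.v *)
Require Import Defs.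
From HB Require Import structures.
From mathcomp Require Import all_boot all_order all_algebra.
From mathcomp Require Import reals complex.
From mathcomp Require Import all_solvable all_field zify ring.

Import Order.TTheory GRing.Theory Num.Theory.
Local Open Scope ring_scope.

Set Implicit Arguments.
Unset Strict Implicit.
Unset Printing Implicit Defensive.

(** A harmonic frame splits into regular simplices as soon as the difference set
    D is disjoint from a subgroup H of the right order. Let d = #|D|, let lambda
    be the number of representations of a nonzero element as a difference in D,
    and let s + 1 be the index of H in G. The characters that agree with a given
    one on H form a block of s + 1 characters, and orthogonality makes the
    functions in a block sum to a multiple of a function supported on H, hence to
    zero on D ([sum_block], [sum_block_harmonic]). So the s inner products of one
    vector of the block with the others add up to - d. Each has modulus
    sqrt (d - lambda) ([norm_inner_harmonic]). If this modulus is d / s, which is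
    the equation s^2 d = d^2 + s^2 lambda, then equality holds in the triangle
    inequality and every inner product is - d / s ([block_inner]). A zero-sum
    family of s + 1 vectors with this Gram matrix is a regular s-simplex
    ([regular_simplex_of_gram]). The number of blocks is #|H|. All this rests on
    the duality of finite abelian groups, which reduces to the fact that
    characters separate points ([dual_separates]). The criterion is packaged in
    [etf_of_fine_difference_set].

    It remains to exhibit three difference sets with such a subgroup.
    - In case (a), G is the cyclic group of the nonzero elements of the field of
      order q^(2f) modulo those of its subfield of order q, and D is the
      complement of a hyperplane (a Singer set). Choosing the hyperplane so that
      it contains the subfield of order q^f makes D disjoint from the image H of
      that subfield.
    - In case (b), G is Z/(r+1) x F, where F has order q^(e+1) and r is the number
      of hyperplanes of F over the field of order q. D is the union of the r
      hyperplanes, each put in its own slice; one slice is left over, the zero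
      slice, and it is H (a McFarland set).
    - In case (c), G = E x F with #|E| = q and #|F| = q + 2, and D consists of the
      (0, y) with y nonzero and of the (x, y) whose quadratic characters have
      product - 1 (the complement of a twin prime power set). It misses
      H = E x 0.

    In (a) and (b) the counts follow from one fact about the trace tr onto the
    subfield Fq: if g is outside Fq then x |-> (tr x, tr (g x)) is onto Fq x Fq,
    so all its fibers have the same size ([card_tr_fiber2]). In (c) twice the
    indicator of D is a difference of two products of a function of x and a
    function of y, so that its autocorrelation is a combination of products of
    one-variable correlations, which are easy to compute
    ([twin_autocorrelation]). *)

(** * Characters of a finite abelian group *)

Lemma mulrn_card (G : finZmodType) (x : G) : x *+ #|G| = 0.
Proof.
have : \sum_(y : G) (x + y) = \sum_(y : G) y.
  by rewrite [RHS](reindex_inj (addrI x)).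
by rewrite big_split /= sumr_const => /(canRL (addrK _)); rewrite subrr.
Qed.

Section Characters.
Variables (G : finZmodType) (C : numClosedFieldType).
Local Notation dual := (pontryagin_dual G C).
Implicit Types (u v : dual) (x y : G).

(** Unitarity is automatic: the values are #|G|-th roots of unity. *)
Lemma dual_of_morphism (f : G -> C) :
  f 0 = 1 -> (forall x y, f (x + y) = f x * f y) -> exists u, forall x, u x = f x.
Proof.
move=> f0 fD.
have fX x k : f (x *+ k) = f x ^+ k.
  by elim: k => [|k IHk]; rewrite ?mulr0n // mulrS exprS fD IHk.
have f_char : is_unitary_char [ffun x => f x].
  apply/andP; split; last by apply/forallP=> x; apply/forallP=> y; rewrite !ffunE fD.
  apply/forallP=> x; rewrite ffunE.
  have G_gt0 : (0 < #|{: G}|)%N by apply/card_gt0P; exists 0.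
  by rewrite -(pexpr_eq1 G_gt0) // -normrX -fX mulrn_card f0 normr1.
by exists (PontryaginDual f_char) => x; rewrite /= ffunE.
Qed.

(** The translation operators on functions on G commute, and each has finite
    order, hence is diagonalizable in characteristic 0. In a basis of common
    eigenvectors every diagonal entry is a character; if all of them were trivial
    at x, then the translation by x would be the identity. *)
Lemma dual_separates x : x != 0 -> exists u, u x != 1.
Proof.
move=> x_neq0.
have [n [f [g fK gK]]] : exists n (f : 'I_n.+1 -> G), bijective f.
  have G_gt0 : (0 < #|{: G}|)%N by apply/card_gt0P; exists 0.
  exists #|{: G}|.-1, (fun i => enum_val (cast_ord (prednK G_gt0) i)).
  apply: bij_comp; first exact: enum_val_bij.
  by exists (cast_ord (esym (prednK G_gt0))); [exact: cast_ordK | exact: cast_ordKV].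
pose M y : 'M[C]_n.+1 := \matrix_(i, j) (f j == f i + y)%:R.
have MD y z : M (y + z) = M y *m M z.
  apply/matrixP=> i j; rewrite !mxE (bigD1 (g (f i + y))) //= !mxE gK eqxx mul1r.
  rewrite big1 ?addr0 ?addrA // => k k_neq; rewrite !mxE (can2_eq fK gK).
  by rewrite (negbTE k_neq) mul0r.
have M0 : M 0 = 1%:M.
  by apply/matrixP=> i j; rewrite !mxE addr0 (can_eq fK) eq_sym.
have MX y k : M (y *+ k) = M y ^+ k.
  by elim: k => [|k IHk]; rewrite ?mulr0n ?M0 // mulrS exprS MD IHk.
have [P Punit /allP Pdiag] :
    exists2 P, P \in unitmx & all [pred A | diagonalizable_for P A] [seq M y | y : G].
  apply/mxpoly.codiagonalizableP; split=> [A B /mapP[y _ ->] /mapP[z _ ->]|].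
    by rewrite /comm_mx -!MD addrC.
  move=> A /mapP[y _ ->]; apply/mxpoly.diagonalizableP.
  have n_neq0 : #|{: G}|%:R != 0 :> C.
    by rewrite pnatr_eq0 -lt0n; apply/card_gt0P; exists 0.
  have [rs def_rs] := closed_field_poly_normal ('X^#|{: G}| - 1 : {poly C}).
  rewrite lead_coefXnsubC ?scale1r in def_rs; last first.
    by apply/card_gt0P; exists 0.
  exists rs; first by rewrite -separable_prod_XsubC -def_rs separable_Xn_sub_1.
  rewrite -def_rs; apply: mxminpoly_min.
  by rewrite rmorphB rmorphXn /= horner_mx_X rmorph1 -MX mulrn_card M0 subrr.
pose D y := P *m M y *m invmx P.
have D_diag y : is_diag_mx (D y).
  by rewrite /D -conjumx //; apply: Pdiag; apply/mapP; exists y; rewrite ?mem_enum.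
have DD y z : D (y + z) = D y *m D z.
  by rewrite /D MD !mulmxA mulmxKV.
have D0 : D 0 = 1%:M by rewrite /D M0 mulmx1 mulmxV.
have D_mult i y z : D (y + z) i i = D y i i * D z i i.
  rewrite DD mxE (bigD1 i) //= big1 ?addr0 // => k k_neq.
  by have /is_diag_mxP-> := D_diag y; rewrite ?mul0r // eq_sym.
case: (pickP (fun i => D x i i != 1)) => [i Di_neq1 | D_eq1].
  have [||u def_u] := @dual_of_morphism (fun y => D y i i).
  - by rewrite D0 mxE eqxx.
  - exact: D_mult.
  by exists u; rewrite def_u.
have Dx1 : D x = 1%:M.
  apply/matrixP=> i j; rewrite [RHS]mxE; case: eqP => [<-|/eqP ij].
    by have /negbFE/eqP-> := D_eq1 i.
  by have /is_diag_mxP-> := D_diag x.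
have Mx1 : M x = 1%:M.
  have -> : M x = invmx P *m D x *m P by rewrite /D !mulmxA mulVmx // mul1mx mulmxKV.
  by rewrite Dx1 mulmx1 mulVmx.
have /matrixP/(_ ord0 ord0)/eqP := Mx1; rewrite !mxE eqxx pnatr_eq1.
rewrite -{1}[f ord0]addr0 (inj_eq (addrI _)) eqb1 eq_sym.
by rewrite (negbTE x_neq0).
Qed.

Lemma dual0 u : u 0 = 1.
Proof.
have /eqP := dualD u 0 0; rewrite addr0 -{1}[u 0]mulr1 (inj_eq (mulfI _)).
  by move/eqP.
by rewrite -normr_eq0 dual_norm oner_eq0.
Qed.

Lemma dualN u x : u (- x) = (u x)^*.
Proof.
have ux_neq0 : u x != 0 by rewrite -normr_eq0 dual_norm oner_eq0.
by apply: (mulfI ux_neq0); rewrite -dualD subrr dual0 -normCK dual_norm expr1n.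
Qed.

(** The orthogonality argument: translating by h0 multiplies the sum by f h0. *)
Lemma sum_mult_eq0 (H : {pred G}) (f : G -> C) h0 :
  h0 \in H -> (forall x, (h0 + x \in H) = (x \in H)) ->
  (forall x, f (h0 + x) = f h0 * f x) -> f h0 != 1 -> \sum_(x in H) f x = 0.
Proof.
move=> Hh0 H_inv f_mult fh0_neq1.
have /eqP : \sum_(x in H) f x = f h0 * \sum_(x in H) f x.
  rewrite [LHS](reindex_inj (addrI h0)) mulr_sumr.
  by apply: eq_big => [x | x _]; rewrite ?H_inv ?f_mult.
rewrite -subr_eq0 -{1}[\sum_(x in H) _]mul1r -mulrBl mulf_eq0 subr_eq0 eq_sym.
by rewrite (negbTE fh0_neq1) => /eqP.
Qed.

Lemma sum_dual_eq0 x : x != 0 -> \sum_(u : dual) u x = 0.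
Proof.
move=> /dual_separates[u0 u0x].
have mulP v : exists w : dual, [forall y, w y == u0 y * v y].
  have [||w def_w] := @dual_of_morphism (fun y => u0 y * v y).
  - by rewrite !dual0 mulr1.
  - by move=> y z; rewrite !dualD mulrACA.
  by exists w; apply/forallP=> y; rewrite def_w.
pose mul v := xchoose (mulP v).
have mulE v y : mul v y = u0 y * v y by have /forallP/(_ y)/eqP := xchooseP (mulP v).
have mul_inj : injective mul.
  move=> v w eq_vw; apply: val_inj; apply/ffunP=> y.
  have := mulE v y; rewrite eq_vw mulE => /esym/mulfI; apply.
  by rewrite -normr_eq0 dual_norm oner_eq0.
have /eqP : \sum_(u : dual) u x = u0 x * \sum_(u : dual) u x.
  rewrite [LHS](reindex_inj mul_inj) mulr_sumr.
  by apply: eq_bigr => v _; rewrite mulE.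
rewrite -subr_eq0 -{1}[\sum_(u : dual) _]mul1r -mulrBl mulf_eq0 subr_eq0 eq_sym.
by rewrite (negbTE u0x) => /eqP.
Qed.

Lemma dual_neq u v : u != v -> exists x, u x != v x.
Proof.
move=> u_neq_v; apply/existsP; apply: contraR u_neq_v => /existsPn eq_uv.
by apply/eqP/val_inj/ffunP=> x; apply/eqP/negPn/eq_uv.
Qed.

(** The function (u x)^* * v x is the quotient of two characters. This and the
    next lemma let orthogonality apply to it without building it as an element of
    the dual. *)
Lemma conj_dual_mult u v h x : (u (h + x))^* * v (h + x) = ((u h)^* * v h) * ((u x)^* * v x).
Proof. by rewrite !dualD rmorphM /= mulrACA. Qed.

Lemma conj_dual_eq1 u v x : ((u x)^* * v x == 1) = (u x == v x).
Proof.
have ux_neq0 : u x != 0 by rewrite -normr_eq0 dual_norm oner_eq0.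
by rewrite -(inj_eq (mulfI ux_neq0)) mulrA -normCK dual_norm expr1n mul1r mulr1 eq_sym.
Qed.

(** Both orders of summation of u x over all u and x are computed: only the
    trivial character contributes to one, only x = 0 to the other. *)
Lemma card_dual : #|{: dual}| = #|G|.
Proof.
have [||u0 u0E] := @dual_of_morphism (fun _ => 1); rewrite ?mulr1 //.
apply/eqP; rewrite -(eqr_nat C).
have sum1 : \sum_(u : dual) \sum_(x : G) u x = #|G|%:R.
  rewrite (bigD1 u0) //= [X in X + _](eq_bigr (fun _ => 1)) => [|x _]; last exact: u0E.
  rewrite sumr_const big1 ?addr0 // => u u_neq.
  have [h uh] := dual_neq u_neq; rewrite u0E in uh.
  by apply: (@sum_mult_eq0 predT _ h) => // x; rewrite dualD.
rewrite -sum1 exchange_big /= (bigD1 0) //= [X in _ + X]big1 ?addr0 => [|x x_neq0]; last exact: sum_dual_eq0.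
by under eq_bigr do rewrite dual0; rewrite sumr_const.
Qed.

Lemma sum_dualE x : \sum_(u : dual) u x = #|G|%:R *+ (x == 0).
Proof.
case: eqP => [-> | /eqP x_neq0]; last by rewrite sum_dual_eq0.
by under eq_bigr do rewrite dual0; rewrite sumr_const card_dual.
Qed.

End Characters.

(** * Regular simplices from their Gram matrix *)

Section Inner.
Variables (C : numClosedFieldType) (T : finType).
Implicit Types x y : cvec C T.

Lemma innerDr x y z : inner x (y + z) = inner x y + inner x z.
Proof. by rewrite -big_split; apply: eq_bigr => t _; rewrite ffunE mulrDr. Qed.

Lemma innerZr x a y : inner x (a *: y) = a * inner x y.
Proof. by rewrite mulr_sumr; apply: eq_bigr => t _; rewrite ffunE mulrCA. Qed.

Lemma inner0r x : inner x 0 = 0.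
Proof. by apply: big1 => t _; rewrite ffunE mulr0. Qed.

Lemma inner_sumr (I : finType) x (y : I -> cvec C T) :
  inner x (\sum_i y i) = \sum_i inner x (y i).
Proof.
by apply: (big_morph (inner x)); [exact: innerDr | exact: inner0r].
Qed.
End Inner.

Section SimplexCriterion.
Variables (C : numClosedFieldType) (T I : finType) (s : nat) (d : C).
Variable phi : I -> cvec C T.
Hypotheses (s_gt0 : (0 < s)%N) (cardI : #|I| = s.+1) (d_gt0 : 0 < d).
Hypothesis phi_norm : forall l, inner (phi l) (phi l) = d.
Hypothesis phi_inner : forall l l', l != l' -> inner (phi l) (phi l') = - (d / s%:R).
Hypothesis phi_sum0 : \sum_l phi l = 0.

(** The Gram matrix is frame_bound times the identity minus d / s times the
    all-ones matrix. *)
Let frame_bound := d + d / s%:R.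

Lemma simplex_inner_comb (c : I -> C) k :
  inner (phi k) (\sum_l c l *: phi l) = frame_bound * c k - d / s%:R * \sum_l c l.
Proof.
rewrite inner_sumr (bigD1 k) //= [\sum_l c l](bigD1 k) //=.
rewrite innerZr phi_norm (eq_bigr (fun l => - (d / s%:R) * c l)) => [|l l_neq].
  by rewrite -mulr_sumr mulrDr mulNr opprD addrA mulrDl addrK mulrC.
by rewrite innerZr phi_inner 1?eq_sym // mulrC.
Qed.

(** As the vectors sum to zero, the d / s part of the Gram matrix contributes
    d / s times phi k. *)
Lemma simplex_tight k : \sum_l inner (phi l) (phi k) *: phi l = frame_bound *: phi k.
Proof.
rewrite (bigD1 k) //= (eq_bigr (fun l => - (d / s%:R) *: phi l)) => [|l l_neq].
  rewrite -scaler_sumr phi_norm /frame_bound scalerDl; congr (_ + _).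
  have /eqP := phi_sum0; rewrite (bigD1 k) //= addr_eq0 => /eqP->.
  by rewrite scalerN scaleNr.
by rewrite phi_inner.
Qed.

Lemma frame_bound_gt0 : 0 < frame_bound.
Proof. by rewrite addr_gt0 // divr_gt0 // ltr0n. Qed.

Lemma simplex_is_etf : is_etf (family_span phi) phi.
Proof.
split.
- move=> l; split; first exact/memv_span/codom_f.
  apply: contraTneq d_gt0 => phil0.
  by rewrite -(phi_norm l) phil0 inner0r ltxx.
- by move=> l l'; rewrite /hnorm !phi_norm.
- by exists `|- (d / s%:R)| => l l' neq; rewrite phi_inner.
exists frame_bound; split=> [|y]; first exact: frame_bound_gt0.
rewrite /family_span => /(@coord_span _ _ _ (in_tuple (codom phi))).
pose c i := coord (in_tuple (codom phi)) i y; rewrite -/(c _) => y_comb.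
rewrite y_comb (eq_bigr (fun l => \sum_(i < size (codom phi))
  c i *: (inner (phi l) (codom phi)`_i *: phi l))) => [|l _]; last first.
  rewrite inner_sumr scaler_suml; apply: eq_bigr => i _.
  by rewrite innerZr scalerA.
rewrite exchange_big scaler_sumr; apply: eq_bigr => i _ /=.
rewrite -scaler_sumr scalerA mulrC -scalerA.
have /codomP[k ->] : (codom phi)`_i \in codom phi by apply: mem_nth.
by rewrite simplex_tight.
Qed.

Definition synthesis (c : {ffun I -> C^o}) : cvec C T := \sum_l c l *: phi l.

Lemma synthesis_is_linear : linear synthesis.
Proof.
move=> a b c; rewrite /synthesis scaler_sumr -big_split; apply: eq_bigr => l _ /=.
by rewrite !ffunE scalerDl scalerA.
Qed.
HB.instance Definition _ :=
  GRing.isLinear.Build C {ffun I -> C^o} (cvec C T) _ synthesis synthesis_is_linear.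

(** The relations between the vectors are the constant ones: pairing a relation c
    with phi k gives frame_bound * c k = d / s * sum c, which does not depend on
    k. *)
Lemma simplex_dim_span : \dim (family_span phi) = s.
Proof.
pose one : {ffun I -> C^o} := [ffun=> 1].
have im_syn : limg (linfun synthesis) = family_span phi.
  apply/eqP; rewrite eqEsubv; apply/andP; split.
    apply/subvP=> _ /memv_imgP[c _ ->]; rewrite lfunE /=.
    apply: memv_suml => l _; apply: memvZ; exact/memv_span/codom_f.
  apply/span_subvP=> _ /codomP[k ->]; apply/memv_imgP.
  exists [ffun l => (l == k)%:R]; rewrite ?memvf // lfunE /= /synthesis.
  rewrite (bigD1 k) //= ffunE eqxx scale1r big1 ?addr0 // => l l_neq.
  by rewrite ffunE (negbTE l_neq) scale0r.
have ker_syn : lker (linfun synthesis) = <[one]>%VS.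
  apply/eqP; rewrite eqEsubv; apply/andP; split; apply/subvP=> c.
    rewrite memv_ker lfunE /= => /eqP c_ker; apply/vlineP.
    exists (d / s%:R * (\sum_l c l) / frame_bound); apply/ffunP=> k.
    have /eqP := simplex_inner_comb c k; rewrite [X in inner _ X]c_ker inner0r eq_sym subr_eq0.
    move/eqP=> <-; rewrite !ffunE mulrAC mulfV ?gt_eqF ?frame_bound_gt0 //.
    by rewrite mul1r; apply/esym/mulr1.
  move=> /vlineP[a ->]; rewrite memv_ker lfunE /= linearZ /=.
  rewrite [synthesis one](_ : _ = 0) ?scaler0 // -phi_sum0.
  by apply: eq_bigr => l _; rewrite ffunE scale1r.
have := limg_ker_dim (linfun synthesis) fullv.
rewrite capfv ker_syn im_syn dim_vline dimvf /dim /= muln1 cardI.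
case: eqP => [one0 | _ [] //].
have [l _] : exists l : I, l \in I by apply/card_gt0P; rewrite cardI.
by have /ffunP/(_ l)/eqP := one0; rewrite !ffunE oner_eq0.
Qed.

Lemma regular_simplex_of_gram : regular_simplex s phi.
Proof. by split=> //; [exact: simplex_is_etf | exact: simplex_dim_span]. Qed.

End SimplexCriterion.

(** * Harmonic frames of difference sets *)

Lemma card_differences (G : finZmodType) (D : {set G}) (g : G) :
  #|[set p in setX D D | g == p.1 - p.2]| = #|[set y in D | y + g \in D]|.
Proof.
rewrite -(card_imset (mem [set y in D | y + g \in D]) (f := fun y => (y + g, y))).
  apply: eq_card => -[a b]; rewrite !inE /=.
  apply/andP/imsetP => [[/andP[Da Db] /eqP->] | [y]].
    by exists b; rewrite ?inE ?Db addrC subrK.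
  by rewrite inE => /andP[Dy Dyg] [-> ->]; rewrite Dy Dyg addrAC subrr add0r.
by move=> y z [].
Qed.

Section Harmonic.
Variables (G : finZmodType) (C : numClosedFieldType) (D : {set G}) (lambda : nat).
Local Notation dual := (pontryagin_dual G C).
Implicit Types (u v : dual) (x y : G).
Local Notation phi := (harmonic C D).
Local Notation d := (#|D|%:R : C).

Hypothesis D_diff : forall g, g != 0 -> #|[set p in setX D D | g == p.1 - p.2]| = lambda.

Lemma inner_harmonic u v : inner (phi u) (phi v) = \sum_(x in D) (u x)^* * v x.
Proof. by rewrite big_sub; apply: eq_bigr => t _; rewrite !ffunE. Qed.

Lemma inner_harmonic_diag u : inner (phi u) (phi u) = d.
Proof.
rewrite inner_harmonic -sumr_const; apply: eq_bigr => x _.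
by rewrite mulrC -normCK dual_norm expr1n.
Qed.

(** The square is the sum over D x D of the nontrivial character f = u^* v at the
    differences. It equals #|D| * f 0 + lambda * (sum of f over nonzero
    elements), and f sums to zero. *)
Lemma norm_inner_harmonic u v : u != v ->
  `|inner (phi u) (phi v)| ^+ 2 = d - lambda%:R.
Proof.
move=> u_neq; rewrite normCK inner_harmonic.
pose f x := (u x)^* * v x.
have f_sub x y : f x * (f y)^* = f (x - y).
  by rewrite /f !dualD !dualN !rmorphM /= conjCK mulrACA.
have -> : (\sum_(x in D) f x) * (\sum_(x in D) f x)^* =
    \sum_(p in setX D D) f (p.1 - p.2).
  rewrite rmorph_sum mulr_suml; under eq_bigr do rewrite mulr_sumr.
  rewrite pair_big; apply: eq_big => [p | p _] /=; last exact: f_sub.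
  by rewrite inE.
rewrite (partition_big (fun p => p.1 - p.2) predT) //=.
rewrite (eq_bigr (fun h => f h *+ #|[set p in setX D D | h == p.1 - p.2]|)) => [|h _].
  have f_sum : \sum_x f x = 0.
    have [h uh] := dual_neq u_neq.
    apply: (@sum_mult_eq0 _ _ predT _ h) => // [x|]; first exact: conj_dual_mult.
    by rewrite conj_dual_eq1.
  rewrite (bigD1 0) //= (eq_bigr (fun h => f h *+ lambda)) => [|h /D_diff-> //].
  have /eqP := f_sum; rewrite (bigD1 0) //= addrC addr_eq0 sumrMnl => /eqP->.
  have f0 : f 0 = 1 by rewrite /f !dual0 rmorph1 mulr1.
  rewrite f0 mulNrn card_differences; congr (_%:R - _).
  by apply: eq_card => y; rewrite inE addr0 andbb.
rewrite -sumr_const; apply: eq_big => [p | p /andP[_ /eqP-> //]].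
by rewrite inE [h == _]eq_sym.
Qed.

Lemma harmonic_is_etf : (0 < #|D|)%N -> is_etf fullv phi.
Proof.
move=> D_gt0; split.
- move=> u; rewrite memvf; split=> //.
  apply/eqP=> phi0; have /eqP := inner_harmonic_diag u.
  by rewrite phi0 inner0r eq_sym pnatr_eq0 eqn0Ngt D_gt0.
- by move=> u v; rewrite /hnorm !inner_harmonic_diag.
- exists (sqrtC (d - lambda%:R)) => u v /norm_inner_harmonic <-.
  by rewrite exprCK.
exists #|G|%:R; split=> [|y _].
  by rewrite ltr0n; apply/card_gt0P; exists 0.
apply/ffunP=> t; rewrite sum_ffunE ffunE.
rewrite (eq_bigr (fun u : dual => \sum_t' y t' * u (val t - val t'))) => [|u _].
  rewrite exchange_big (bigD1 t) //= -mulr_sumr subrr sum_dualE eqxx mulrC.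
  rewrite big1 ?addr0 // => t' t'_neq.
  by rewrite -mulr_sumr sum_dualE subr_eq0 (inj_eq val_inj) eq_sym (negbTE t'_neq) mulr0.
rewrite ffunE [LHS]mulr_suml; apply: eq_bigr => t' _.
by rewrite !ffunE dualD dualN mulrAC mulrC mulrCA mulrC -mulrA.
Qed.

(** * Blocks of characters that agree on a subgroup *)

Section Block.
Variables (H : {set G}) (s : nat).
Hypotheses (H0 : 0 \in H) (HB : forall x y, x \in H -> y \in H -> x - y \in H).
Hypothesis HD : [disjoint H & D].
Hypothesis cardH : (#|H| * s.+1 = #|G|)%N.
Hypothesis D_gt0 : (0 < #|D|)%N.
(** This says that d / s is the modulus sqrt (d - lambda) of the inner products,
    i.e. that s is the inverse of the Welch bound. *)
Hypothesis welch : (s ^ 2 * #|D| = #|D| ^ 2 + s ^ 2 * lambda)%N.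

(** Extending by zero outside H keeps the values in a type that does not depend
    on H. *)
Definition restr u : {ffun G -> C} := [ffun x => u x *+ (x \in H)].

Lemma restrP u v : reflect {in H, u =1 v} (restr u == restr v).
Proof.
apply: (iffP eqP) => [eq_uv x Hx | eq_uv].
  by have /ffunP/(_ x) := eq_uv; rewrite !ffunE Hx.
by apply/ffunP=> x; rewrite !ffunE; case: (boolP (x \in H)) => // /eq_uv->.
Qed.

Lemma H_shift h x : h \in H -> (h + x \in H) = (x \in H).
Proof.
move=> Hh; apply/idP/idP => [Hhx | Hx].
  by rewrite -[x](addKr h) addrC; apply: HB.
by rewrite -[x]opprK; apply: HB => //; rewrite -sub0r; apply: HB.
Qed.

(** Orthogonality on H turns the condition that v agrees with u on H into the
    average of u^* v over H; summing over all v then leaves only the term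
    h = - x. *)
Lemma sum_block u x :
  #|H|%:R * \sum_(v : dual | restr u == restr v) v x = #|G|%:R *+ (- x \in H) * u x.
Proof.
have -> : #|G|%:R *+ (- x \in H) * u x = \sum_(h in H) (u h)^* * \sum_(v : dual) v (h + x).
  under eq_bigr do rewrite sum_dualE addr_eq0.
  have [Hx | Hx] := boolP (- x \in H).
    rewrite (bigD1 (- x)) //= eqxx dualN conjCK mulrC big1 ?addr0 // => h.
    by case/andP=> _ /negbTE->; rewrite mulr0.
  rewrite mul0r big1 // => h Hh; case: eqP => [eq_h | _]; last by rewrite mulr0.
  by rewrite -eq_h Hh in Hx.
under [RHS]eq_bigr do rewrite mulr_sumr.
rewrite exchange_big big_mkcond mulr_sumr; apply: eq_bigr => v _ /=.
under [RHS]eq_bigr do rewrite dualD mulrA.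
rewrite -mulr_suml; case: restrP => [eq_uv | neq_uv].
  congr (_ * _); rewrite -sumr_const; apply: eq_bigr => h Hh.
  by rewrite -eq_uv // mulrC -normCK dual_norm expr1n.
rewrite mulr0 (_ : \sum_(h in H) _ = 0) ?mul0r //.
have /existsP[h /andP[Hh uh]] : [exists h, (h \in H) && (u h != v h)].
  apply: contra_notT neq_uv => /existsPn all_eq h Hh.
  by have := all_eq h; rewrite Hh => /negPn/eqP.
apply: (sum_mult_eq0 Hh) => [x' | x' |]; first exact: H_shift.
  exact: conj_dual_mult.
by rewrite conj_dual_eq1.
Qed.

Let H_gt0 : (0 < #|H|)%N. Proof. by apply/card_gt0P; exists 0. Qed.

Lemma card_block u : #|[set v : dual | restr u == restr v]| = s.+1.
Proof.
have := sum_block u 0; rewrite oppr0 H0 dual0 mulr1.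
under eq_bigr do rewrite dual0.
rewrite sumr_const -natrM mulr1n -[in RHS]cardH => /eqP; rewrite eqr_nat eqn_pmul2l // => /eqP<-.
by apply: eq_card => v; rewrite inE.
Qed.

Lemma sum_block_harmonic u : \sum_(v : dual | restr u == restr v) phi v = 0.
Proof.
apply/ffunP=> t; rewrite sum_ffunE ffunE; under eq_bigr do rewrite ffunE.
have H_neq0 : #|H|%:R != 0 :> C by rewrite pnatr_eq0 -lt0n.
apply: (mulfI H_neq0); rewrite sum_block mulr0.
have [Ht|] := boolP (- val t \in H); last by rewrite mul0r.
have Ht' : val t \in H by rewrite -[val t]opprK -sub0r; apply: HB.
by have /pred0P/(_ (val t)) := HD; rewrite /= Ht' (valP t).
Qed.

Lemma s_gt0 : (0 < s)%N.
Proof.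
rewrite lt0n; apply: contraTneq D_gt0 => s0; move/eqP: welch.
by rewrite s0 !mul0n addn0 eq_sym expn_eq0 -lt0n => /andP[/eqP->].
Qed.

Lemma norm_inner_block u v : u != v -> `|inner (phi u) (phi v)| = d / s%:R.
Proof.
move=> u_neq; have s_neq0 : s%:R != 0 :> C by rewrite pnatr_eq0 -lt0n s_gt0.
apply/eqP; rewrite -(@eqrXn2 _ 2) ?divr_ge0 ?ler0n //.
rewrite norm_inner_harmonic // expr_div_n; apply/eqP.
apply: (mulIf (expf_neq0 2 s_neq0)); rewrite divfK ?expf_neq0 // mulrC mulrBr.
by rewrite -!natrX -!natrM welch natrD addrK.
Qed.

(** The s inner products of phi u with the other vectors of its block sum to - d
    while their moduli sum to d. So they all have the same argument. *)
Lemma block_inner u v : restr u == restr v -> u != v ->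
  inner (phi u) (phi v) = - (d / s%:R).
Proof.
move=> eq_uv u_neq; have s_neq0 : s%:R != 0 :> C by rewrite pnatr_eq0 -lt0n s_gt0.
pose B v' := (restr u == restr v') && (v' != u).
have sumB : \sum_(v' | B v') inner (phi u) (phi v') = - d.
  have /(congr1 (inner (phi u))) := sum_block_harmonic u.
  rewrite (bigD1 u) //= innerDr inner_harmonic_diag inner0r => /eqP.
  rewrite addrC addr_eq0 => /eqP <-; symmetry.
  by apply: (big_morph (inner (phi u))); [exact: innerDr | exact: inner0r].
have cardB : #|[pred v' | B v']| = s.
  have := card_block u; rewrite (cardD1 u) inE eqxx => -[<-].
  by apply: eq_card => v'; rewrite !inE andbC.
have normB : \sum_(v' | B v') `|inner (phi u) (phi v')| = d.
  rewrite (eq_bigr (fun=> d / s%:R)) => [|v' /andP[_ v'_neq]].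
    by rewrite sumr_const cardB -[LHS]mulr_natr divfK.
  by rewrite norm_inner_block // eq_sym.
have [|t _ def_t] := @normC_sum_eq C _ B (fun v' => inner (phi u) (phi v')).
  by rewrite sumB normB normrN ger0_norm.
have t_eq : t = -1.
  have d_neq0 : d != 0 by rewrite pnatr_eq0 -lt0n.
  apply: (mulfI d_neq0); rewrite mulrN1 -sumB (eq_bigr _ def_t) -mulr_suml.
  by rewrite normB.
by rewrite def_t ?/B ?eq_uv 1?eq_sym // norm_inner_block // t_eq mulrN1.
Qed.

Lemma harmonic_simplices : disjoint_union_of_simplices #|H| s phi.
Proof.
exists (preim_partition restr [set: dual]).
have P_part := preim_partitionP restr [set: dual].
have P_block K : K \in preim_partition restr [set: dual] ->
    exists u, K = [set v : dual | restr u == restr v].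
  case/imsetP=> u _ ->; exists u; apply/setP=> v; by rewrite !inE.
split=> // [|_ /P_block[u ->]].
  have unif : {in preim_partition restr [set: dual], forall A : {set dual}, #|A| = s.+1}.
    by move=> K /P_block[u ->]; apply: card_block.
  have := card_uniform_partition unif P_part; rewrite cardsT card_dual -cardH.
  by move/eqP; rewrite eqn_pmul2r // => /eqP.
set K := [set _ | _].
apply: (@regular_simplex_of_gram _ _ _ _ d).
- exact: s_gt0.
- by rewrite card_sig card_block.
- by rewrite ltr0n.
- by move=> l; apply: inner_harmonic_diag.
- move=> l l' l_neq; apply: block_inner => //.
  have /[!inE]/eqP <- := valP l; by have /[!inE] := valP l'.
rewrite -[RHS](sum_block_harmonic u) [RHS](eq_bigl (mem K)) => [|v].
  by rewrite [RHS]big_sub.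
by rewrite /= inE.
Qed.

End Block.
End Harmonic.

(** The conclusion of the theorem, named so that the three constructions can be
    stated separately. *)
Definition harmonic_simplex_etf (R : realType) (d n v s : nat) : Prop :=
  exists (G : finZmodType) (D : {set G}),
    [/\ difference_set D, #|G| = n /\ #|{: pontryagin_dual G R[i]}| = n, #|D| = d,
        is_etf fullv (harmonic R[i] D) & disjoint_union_of_simplices v s (harmonic R[i] D)].

(** The difference property is asked for in the form in which it is checked below:
    every nonzero shift of D meets D in lambda points. *)
Lemma etf_of_fine_difference_set (R : realType) (G : finZmodType) (D H : {set G})
    (lambda d n v s : nat) :
  (forall g, g != 0 -> #|[set y in D | y + g \in D]| = lambda) ->
  0 \in H -> (forall x y, x \in H -> y \in H -> x - y \in H) ->
  [disjoint H & D] -> #|G| = n -> #|D| = d -> #|H| = v -> (v * s.+1 = n)%N ->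
  (0 < d)%N -> (s ^ 2 * d = d ^ 2 + s ^ 2 * lambda)%N ->
  harmonic_simplex_etf R d n v s.
Proof.
move=> D_shift H0 HB HD cardG cardD cardH vs_n d_gt0 welch; exists G, D.
have D_diff g : g != 0 -> #|[set p in setX D D | g == p.1 - p.2]| = lambda.
  by move=> g_neq0; rewrite card_differences D_shift.
split=> //; first by exists lambda.
- by rewrite card_dual cardG.
- by apply: harmonic_is_etf D_diff _; rewrite cardD.
by rewrite -cardH; apply: (harmonic_simplices _ D_diff) => //; rewrite ?cardH ?cardD ?cardG.
Qed.



(** * Trace and hyperplanes of a finite field *)

HB.instance Definition _ (V W : finZmodType) := GRing.Zmodule.on (V * W)%type.

Lemma prime_power_gt1 q : prime_power q -> (1 < q)%N.
Proof. by case=> p [k [p_pr k_gt0 ->]]; rewrite -(exp1n k) ltn_exp2r ?prime_gt1. Qed.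

(** The Frobenius identity expresses that q is a power of the characteristic. It
    is what makes the trace below additive. *)
Lemma finite_field_exists q m : prime_power q -> (0 < m)%N ->
  exists2 F : finFieldType, #|F| = (q ^ m)%N &
    forall i (x y : F), (x + y) ^+ (q ^ i) = x ^+ (q ^ i) + y ^+ (q ^ i).
Proof.
case=> p [k [p_pr k_gt0 ->]] m_gt0.
have [F charF cardF] := @PrimePowerField p (k * m) p_pr (ltac:(by rewrite muln_gt0 k_gt0)).
exists F => [|i x y]; first by rewrite cardF expnM.
by apply: exprDn_pchar; rewrite -expnM pnatX pnatE ?charF.
Qed.

Lemma card_fiber (V W : finZmodType) (h : V -> W) (B : {set W}) b :
  (forall x y, h (x + y) = h x + h y) -> (forall x, h x \in B) ->
  {in B, forall c, exists x, h x = c} -> b \in B ->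
  (#|B| * #|[set x | h x == b]| = #|V|)%N.
Proof.
move=> hD hB h_onto Bb.
rewrite -sum_nat_const -[RHS]sum1_card [RHS](partition_big h (mem B)) /=; last first.
  by move=> x _; apply: hB.
apply: eq_bigr => c /h_onto[x hx]; have [y hy] := h_onto b Bb.
rewrite -sum1_card (reindex_inj (addrI (y - x))) /=.
have hN z : h (- z) = - h z.
  have h0 : h 0 = 0 by apply: (addrI (h 0)); rewrite -hD !addr0.
  by apply: (addrI (h z)); rewrite -hD !subrr.
apply: eq_bigl => z; rewrite !inE !hD hN hx hy.
by rewrite -addrA -[X in _ == X]addr0 (inj_eq (addrI _)) addrC subr_eq0.
Qed.

Section Trace.
Variables (F : finFieldType) (q m : nat).
Hypotheses (q_gt1 : (1 < q)%N) (m_gt0 : (0 < m)%N) (cardF : #|F| = (q ^ m)%N).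
Hypothesis frobD : forall i (x y : F), (x + y) ^+ (q ^ i) = x ^+ (q ^ i) + y ^+ (q ^ i).
Implicit Types x y g c : F.

Let q_gt0 : (0 < q)%N := ltnW q_gt1.

(** The trace to the subfield of order q. It is defined on F itself, so that no
    second field is needed; its values lie in Fq. *)
Definition tr x := \sum_(i < m) x ^+ (q ^ i).
Definition Fq := [set c : F | c ^+ q == c].

Lemma trD x y : tr (x + y) = tr x + tr y.
Proof. by rewrite -big_split; apply: eq_bigr => i _; apply: frobD. Qed.

Lemma tr0 : tr 0 = 0.
Proof. by apply: (addrI (tr 0)); rewrite -trD !addr0. Qed.

Lemma trN x : tr (- x) = - tr x.
Proof. by apply: (addrI (tr x)); rewrite -trD !subrr tr0. Qed.

Lemma FqX c i : c \in Fq -> c ^+ (q ^ i) = c.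
Proof.
by rewrite inE => /eqP cq; elim: i => [|i IHi]; rewrite ?expr1 // expnS exprM cq.
Qed.

Lemma trZ c x : c \in Fq -> tr (c * x) = c * tr x.
Proof.
by move=> Fc; rewrite mulr_sumr; apply: eq_bigr => i _; rewrite exprMn (FqX _ Fc).
Qed.

(** Raising to the power q permutes the terms of the trace cyclically, because
    x ^+ #|F| = x. *)
Lemma tr_Fq x : tr x \in Fq.
Proof.
have frob0 : (0 : F) ^+ q = 0 by rewrite expr0n gtn_eqF.
have frob1 y z : (y + z) ^+ q = y ^+ q + z ^+ q by have := frobD 1 y z; rewrite expn1.
rewrite inE /tr (big_morph (fun y => y ^+ q) frob1 frob0).
rewrite -(prednK m_gt0) big_ord_recr [X in _ == X]big_ord_recl /= addrC.
rewrite -exprM -expnSr prednK // -cardF expf_card expn0 expr1 -subr_eq0 opprD addrACA subrr.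
rewrite add0r subr_eq0; apply/eqP/eq_bigr => i _.
by rewrite -exprM -expnSr.
Qed.

Lemma FqM c1 c2 : c1 \in Fq -> c2 \in Fq -> c1 * c2 \in Fq.
Proof. by rewrite !inE exprMn => /eqP-> /eqP->. Qed.

Lemma FqV c : c \in Fq -> c^-1 \in Fq.
Proof. by rewrite !inE exprVn => /eqP->. Qed.

Lemma FqB c1 c2 : c1 \in Fq -> c2 \in Fq -> c1 - c2 \in Fq.
Proof.
rewrite !inE => /eqP F1 /eqP F2; have := frobD 1 (c1 - c2) c2.
by rewrite expn1 subrK F1 F2 => c1E; apply/eqP/(addIr c2); rewrite subrK -c1E.
Qed.

Lemma card_roots_le (p : {poly F}) (A : {set F}) :
  p != 0 -> (forall x, x \in A -> root p x) -> (#|A| < size p)%N.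
Proof.
move=> p_neq0 A_root; rewrite cardE; apply: max_poly_roots => //.
  by apply/allP=> x; rewrite mem_enum => /A_root.
exact: enum_uniq.
Qed.

Lemma card_Fq_le : (#|Fq| <= q)%N.
Proof.
have szX : size ('X^q - 'X : {poly F}) = q.+1.
  by rewrite size_polyDl ?size_polyN ?size_polyXn ?size_polyX.
rewrite -ltnS -szX; apply: card_roots_le => [|x]; first by rewrite -size_poly_gt0 szX.
by rewrite inE rootE !hornerE subr_eq0.
Qed.

Lemma card_ker_tr_le : (#|[set x | tr x == 0%R]| <= q ^ m.-1)%N.
Proof.
pose p : {poly F} := \sum_(i < m) 'X^(q ^ i).
have szp : size p = (q ^ m.-1).+1.
  rewrite /p -(prednK m_gt0) big_ord_recr /= addrC size_polyDl ?size_polyXn //.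
  rewrite ltnS; apply: (leq_trans (size_sum _ _ _)).
  by apply/bigmax_leqP=> i _; rewrite size_polyXn ltn_exp2l.
rewrite -ltnS -szp; apply: card_roots_le => [|x]; first by rewrite -size_poly_gt0 szp.
rewrite inE rootE /p horner_sum => /eqP tr_x; apply/eqP; rewrite -[RHS]tr_x.
by apply: eq_bigr => i _; rewrite hornerXn.
Qed.

(** Fq and the kernel of the trace consist of roots of polynomials of degrees q
    and q^(m-1). The product of these bounds is #|F|, which is also the order of
    the image times that of the kernel; so both bounds are attained and the image
    is Fq. *)
Lemma tr_counts : [/\ #|Fq| = q, #|[set x | tr x == 0%R]| = (q ^ m.-1)%N & tr @: setT = Fq].
Proof.
have im_sub : tr @: setT \subset Fq by apply/subsetP=> _ /imsetP[x _ ->]; apply: tr_Fq.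
have card_im : (#|tr @: setT| * #|[set x | tr x == 0%R]| = q * q ^ m.-1)%N.
  rewrite -expnS prednK // -cardF; apply: card_fiber => [||c /imsetP[x _ ->]|].
  - exact: trD.
  - by move=> x; apply: imset_f.
  - by exists x.
  - by apply/imsetP; exists 0; rewrite ?tr0.
have qm_gt0 : (0 < q ^ m.-1)%N by rewrite expn_gt0 q_gt0.
have le_im : (q <= #|tr @: setT|)%N.
  by rewrite -(leq_pmul2r qm_gt0) -card_im leq_mul2l card_ker_tr_le orbT.
have card_Fq : #|Fq| = q.
  by apply/eqP; rewrite eqn_leq card_Fq_le (leq_trans le_im) // subset_leq_card.
have im_Fq : tr @: setT = Fq by apply/eqP; rewrite eqEcard im_sub card_Fq.
split=> //; move/eqP: card_im; rewrite im_Fq card_Fq eqn_pmul2l //; exact/eqP.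
Qed.

Lemma tr_onto c : c \in Fq -> exists x, tr x = c.
Proof. by case: tr_counts => _ _ <- /imsetP[x _ ->]; exists x. Qed.

Lemma Fq1 : 1 \in Fq. Proof. by rewrite inE expr1n. Qed.
Lemma Fq0 : 0 \in Fq. Proof. by rewrite -tr0 tr_Fq. Qed.

(** Otherwise tr (g * _) vanishes on the kernel of tr, so it equals c * tr for some
    c in Fq; then tr vanishes on the multiples of the unit g - c, which is
    absurd. *)
Lemma tr_independent g : g \notin Fq -> exists2 y, tr y = 0 & tr (g * y) = 1.
Proof.
move=> gFq; have [x0 trx0] := tr_onto Fq1.
case: (pickP (fun y => (tr y == 0) && (tr (g * y) != 0))) => [y /andP[/eqP y_ker gy] | no_y].
  exists ((tr (g * y))^-1 * y); first by rewrite (trZ _ (FqV (tr_Fq _))) y_ker mulr0.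
  by rewrite mulrCA (trZ _ (FqV (tr_Fq _))) mulVf.
pose c := tr (g * x0); have Fc : c \in Fq by apply: tr_Fq.
have tr_gc x : tr ((g - c) * x) = 0.
  have := no_y (x - tr x * x0); rewrite trD trN (trZ _ (tr_Fq x)) trx0 mulr1 subrr eqxx /=.
  move/negbFE/eqP; rewrite mulrBr mulrCA trD trN (trZ _ (tr_Fq x)) => tr_g.
  by rewrite mulrBl trD trN (trZ _ Fc) [c * _]mulrC.
case/eqP: (oner_neq0 F); rewrite -trx0 -(tr_gc ((g - c)^-1 * x0)) mulVKf // subr_eq0.
by apply: contraNneq gFq => ->.
Qed.

Lemma card_tr_fiber c : c \in Fq -> (q * #|[set x | tr x == c]| = q ^ m)%N.
Proof.
have [card_Fq _ _] := tr_counts => Fc; rewrite -{1}card_Fq -cardF.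
by apply: card_fiber => //; [exact: trD | exact: tr_Fq | exact: tr_onto].
Qed.

(** A vector killed by tr and not by tr (g * _), together with a vector of trace 1,
    makes the pair of functionals onto, and the fibers of an additive map are
    equinumerous. *)
Lemma card_tr_fiber2 g c1 c2 : g \notin Fq -> c1 \in Fq -> c2 \in Fq ->
  (q * q * #|[set x | (tr x == c1) && (tr (g * x)%R == c2)]| = q ^ m)%N.
Proof.
have [card_Fq _ _] := tr_counts => gFq Fc1 Fc2.
have := @card_fiber F (F * F)%type (fun x => (tr x, tr (g * x))) (setX Fq Fq) (c1, c2).
rewrite cardsX card_Fq cardF => <- //; last 1 first.
- by rewrite inE Fc1.
- by move=> x y; rewrite mulrDr !trD.
- by move=> x; rewrite inE !tr_Fq.
move=> [a b]; rewrite inE /= => /andP[Fa Fb].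
have [y y_ker trgy] := tr_independent gFq; have [x0 trx0] := tr_onto Fq1.
pose e := b - a * tr (g * x0).
have Fe : e \in Fq by rewrite FqB ?FqM ?tr_Fq.
exists (a * x0 + e * y); rewrite mulrDr 2!(mulrCA g) !trD !(trZ _ Fa) !(trZ _ Fe) y_ker trx0 trgy.
by rewrite !mulr1 mulr0 addr0 [a * _ + _]addrC subrK.
Qed.

Lemma card_ker_trM (u : F) : u != 0 -> (q * #|[set x | tr (u * x)%R == 0%R]| = q ^ m)%N.
Proof.
move=> u_neq0; rewrite -(card_tr_fiber Fq0).
rewrite -(card_imset _ (mulfI u_neq0)); congr (_ * _)%N; apply: eq_card => x; rewrite inE.
apply/imsetP/idP => [[y] | trx]; first by rewrite inE => tr_y ->.
by exists (u^-1 * x); rewrite ?inE mulVKf.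
Qed.

Lemma card_fiber_trM2 (u v c1 c2 : F) : u != 0 -> v / u \notin Fq -> c1 \in Fq -> c2 \in Fq ->
  (q * q * #|[set x | (tr (u * x)%R == c1) && (tr (v * x)%R == c2)]| = q ^ m)%N.
Proof.
move=> u_neq0 uv F1 F2; rewrite -(card_tr_fiber2 uv F1 F2).
rewrite -(card_imset _ (mulfI u_neq0)); congr (_ * _)%N; apply: eq_card => x; rewrite inE.
apply/imsetP/idP => [[y] | tr_x].
  by rewrite inE => tr_y ->; rewrite mulrA divfK.
by exists (u^-1 * x); rewrite ?inE mulVKf // mulrA.
Qed.

Lemma primitive_element_exists : exists w : F, (q ^ m).-1.-primitive_root w.
Proof.
have qm_gt0 : (0 < (q ^ m).-1)%N.
  by rewrite -ltnS prednK ?expn_gt0 ?q_gt0 // -(exp1n m) ltn_exp2r.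
suff /hasP[w _ w_prim] : has (q ^ m).-1.-primitive_root (enum [set~ (0 : F)]) by exists w.
apply: has_prim_root => //; first 1 last.
- exact: enum_uniq.
- by rewrite -cardE cardsC1 cardF.
apply/allP=> x; rewrite mem_enum !inE => x_neq0; rewrite unity_rootE.
apply/eqP/(mulfI x_neq0); rewrite -exprS prednK ?expn_gt0 ?q_gt0 //.
by rewrite -cardF expf_card mulr1.
Qed.

(** Here r is the index of the multiplicative group of Fq in that of F: the powers
    w^0, ..., w^(r-1) represent the points of the projective space of F over
    Fq. *)
Section Primitive.
Variables (w : F) (r : nat).
Hypotheses (w_prim : (q ^ m).-1.-primitive_root w) (r_def : (r * q.-1 = (q ^ m).-1)%N).

Let q1_gt0 : (0 < q.-1)%N. Proof. by rewrite -ltnS prednK. Qed.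
Let r_gt0 : (0 < r)%N.
Proof. by have := prim_order_gt0 w_prim; rewrite -r_def muln_gt0 => /andP[]. Qed.

Lemma prim_neq0 i : w ^+ i != 0.
Proof.
rewrite expf_neq0 //; apply/eqP=> w0; have /eqP := prim_expr_order w_prim.
by rewrite w0 expr0n gtn_eqF ?(prim_order_gt0 w_prim) // eq_sym oner_eq0.
Qed.

(** The element w^i is in Fq when (q - 1) * i is a multiple of the order
    r * (q - 1) of w. *)
Lemma prim_Fq i : (w ^+ i \in Fq) = (r %| i)%N.
Proof.
rewrite inE -exprM -{1}(prednK q_gt0) mulnS exprD -[X in _ == X]mulr1.
rewrite (inj_eq (mulfI (prim_neq0 i))) -(prim_order_dvd w_prim) -r_def.
by rewrite dvdn_pmul2r.
Qed.

Lemma tr_prim_mod z i : (tr (z * w ^+ (i %% r)%N) == 0) = (tr (z * w ^+ i) == 0).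
Proof.
have Fc : w ^+ (i %/ r * r)%N \in Fq by rewrite prim_Fq dvdn_mull.
by rewrite {2}(divn_eq i r) exprD mulrCA (trZ _ Fc) mulf_eq0 (negbTE (prim_neq0 _)).
Qed.

Lemma prim_ratio_Fq i j : (i < r)%N -> (j < r)%N -> i != j -> w ^+ i / w ^+ j \notin Fq.
Proof.
move=> ir jr; wlog ij : i j ir jr / (j < i)%N => [hw neq_ij | _].
  have [ji | ij | eq_ij] := ltngtP j i; [exact: hw | | by rewrite eq_ij eqxx in neq_ij].
  apply/negP=> /FqV; rewrite invf_div; apply/negP/hw => //; by rewrite eq_sym.
rewrite -expfB // prim_Fq gtnNdvd ?subn_gt0 //.
exact: leq_ltn_trans (leq_subr _ _) ir.
Qed.

(** Each projective point has q - 1 nonzero representatives. *)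
Lemma card_projective (P : pred F) :
  (forall c x, c \in Fq -> c != 0 -> P (c * x) = P x) ->
  (#|[set x | (x != 0%R) && P x]| = q.-1 * #|[set j : 'I_r | P (w ^+ j)]|)%N.
Proof.
move=> P_inv; pose f (a : 'I_q.-1 * 'I_r) := w ^+ (a.1 * r + a.2).
have fP a : P (f a) = P (w ^+ a.2).
  by rewrite /f exprD P_inv ?prim_neq0 // prim_Fq dvdn_mull.
have f_lt (a : 'I_q.-1 * 'I_r) : (a.1 * r + a.2 < (q ^ m).-1)%N.
  rewrite -r_def [(r * _)%N]mulnC; apply: (@leq_trans (a.1.+1 * r)); last by rewrite leq_mul2r ltn_ord orbT.
  by rewrite mulSn addnC ltn_add2r.
have f_inj : injective f.
  move=> [a i] [b j] /eqP; rewrite (eq_prim_root_expr w_prim) !modn_small ?(f_lt (_, _)) //=.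
  move=> /eqP eq_ab; congr (_, _); apply: val_inj => /=.
    by have := congr1 (divn^~ r) eq_ab; rewrite !divnMDl // !divn_small ?addn0.
  by have := congr1 (modn^~ r) eq_ab; rewrite !modnMDl !modn_small.
rewrite -[X in (X * _)%N]card_ord -[X in (X * _)%N]cardsT -cardsX -(card_imset _ f_inj).
apply: eq_card => x; rewrite inE; apply/andP/imsetP => [[x_neq0 Px] | [a]].
  have x_root : x ^+ (q ^ m).-1 = 1.
    apply/(mulfI x_neq0); rewrite -exprS prednK ?expn_gt0 ?q_gt0 //.
    by rewrite -cardF expf_card mulr1.
  have [i def_x] := prim_rootP w_prim x_root.
  have ir_lt : (i %/ r < q.-1)%N by rewrite ltn_divLR // mulnC r_def.
  have fx : x = f (Ordinal ir_lt, Ordinal (ltn_pmod i r_gt0)) by rewrite /f /= -divn_eq.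
  by exists (Ordinal ir_lt, Ordinal (ltn_pmod i r_gt0)); rewrite // !inE -fP -fx.
by rewrite !inE /= => Pa ->; rewrite prim_neq0 fP.
Qed.

End Primitive.
End Trace.

(** The witness del = w - w^(q^f) satisfies del^(q^f) = - del. So, for y in the
    subfield of order q^f, the two halves of the sum defining tr (del * y) cancel
    each other. *)
Lemma trace_half_kernel (F : finFieldType) (q f : nat) (w : F) :
  (1 < q)%N -> (0 < f)%N ->
  (forall i (x y : F), (x + y) ^+ (q ^ i) = x ^+ (q ^ i) + y ^+ (q ^ i)) ->
  #|F| = (q ^ (f + f))%N -> w ^+ (q ^ f) != w ->
  exists2 del : F, del != 0 & forall y, y ^+ (q ^ f) = y -> tr q (f + f) (del * y) = 0.
Proof.
move=> q_gt1 f_gt0 frobD cardF w_neq; exists (w - w ^+ (q ^ f)).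
  by rewrite subr_eq0 eq_sym.
set del := w - _ => y y_fix.
have del_frob : del ^+ (q ^ f) = - del.
  have := frobD f del (w ^+ (q ^ f)); rewrite subrK -exprM -expnD -cardF expf_card.
  by move=> def_w; rewrite -[RHS]/(- (w - _)) opprB def_w addrK.
rewrite /tr big_split_ord /= -[RHS](subrr (\sum_(i < f) (del * y) ^+ (q ^ i))).
congr (_ + _); rewrite -sumrN; apply: eq_bigr => i _.
rewrite expnD exprM exprMn del_frob y_fix mulNr.
apply/eqP; rewrite -addr_eq0 -frobD addNr expr0n gtn_eqF // expn_gt0.
by rewrite (ltnW q_gt1).
Qed.

(** * Complements of Singer difference sets *)

Lemma nonkernel_count (q K c : nat) :
  (0 < q -> q * K + c = q * (q * K) -> c = q.-1 * (q * K))%N.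
Proof. by case: q => // p _ /=; lia. Qed.

Lemma two_nonkernels_count (q K U c : nat) :
  (0 < q -> U + K = q * K + q * K -> U + c = q * (q * K) -> c = q.-1 * (K * q.-1))%N.
Proof. by case: q => // p _ /=; lia. Qed.

Lemma singer_welch (q K : nat) :
  (0 < q -> q * (q * K) * (q * K) = (q * K) ^ 2 + q * (q * K) * (K * q.-1))%N.
Proof. by case: q => // p _ /=; lia. Qed.

Lemma card_multiples (v t n : nat) : (0 < t)%N -> (v * t = n)%N ->
  #|[set i : 'I_n | (t %| i)%N]| = v.
Proof.
move=> t_gt0 vt_n; rewrite -[RHS]card_ord.
have lt_n (j : 'I_v) : (j * t < n)%N by rewrite -vt_n ltn_pmul2r.
rewrite -(card_imset (mem 'I_v) (f := fun j => Ordinal (lt_n j))) => [|j k [] /eqP].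
  apply: eq_card => i; rewrite inE; apply/idP/imsetP => [/dvdnP[j def_i] | [j _ ->]].
    have jv : (j < v)%N by rewrite -(ltn_pmul2r t_gt0) vt_n -def_i.
    by exists (Ordinal jv) => //; apply: val_inj.
  exact: dvdn_mull.
by rewrite eqn_pmul2r // => /eqP/val_inj.
Qed.

(** The group Z/n stands for the multiplicative group of F modulo that of Fq, via
    the exponents of w. A shift of D meets D in the projective points outside two
    distinct hyperplanes. The multiples of q^f + 1 are the exponents of the
    subfield of order q^f, on which x |-> tr (del * x) vanishes. *)
Lemma singer_complement_etf (R : realType) (q f n v : nat) :
  prime_power q -> (0 < f)%N -> (v * q.-1 = (q ^ f).-1)%N -> (v * (q ^ f).+1 = n)%N ->
  harmonic_simplex_etf R (q ^ (f + f).-1) n v (q ^ f).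
Proof.
move=> q_pp f_gt0 v_def n_def.
have q_gt1 := prime_power_gt1 q_pp; have q_gt0 := ltnW q_gt1.
set m := (f + f)%N; have m_gt0 : (0 < m)%N by rewrite addn_gt0 f_gt0.
have m_ge2 : (2 <= m)%N by rewrite /m -addn1 leq_add.
have q_le_Qf : (q <= q ^ f)%N by rewrite -{1}[q]expn1 leq_exp2l.
have Qf_gt0 : (0 < q ^ f)%N by rewrite expn_gt0 q_gt0.
have r_def : (n * q.-1 = (q ^ m).-1)%N.
  rewrite -n_def /m expnD mulnAC v_def; nia.
have v_gt0 : (0 < v)%N.
  by case: (posnP v) => // v0; move: v_def; rewrite v0; lia.
case: n => [|n'] in n_def r_def *; first by move: n_def; nia.
have [F cardF frobD] := finite_field_exists q_pp m_gt0.
have [w w_prim] := primitive_element_exists q_gt1 m_gt0 cardF.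
have w_neq : w ^+ (q ^ f) != w.
  rewrite -[X in _ != X]expr1 (eq_prim_root_expr w_prim) !modn_small.
  - by rewrite gtn_eqF // -[1%N](expn0 q) ltn_exp2l.
  - have : (q ^ 2 <= q ^ m)%N by rewrite leq_exp2l.
    by nia.
  by rewrite /m expnD; nia.
have [del del_neq0 del_ker] := trace_half_kernel q_gt1 f_gt0 frobD cardF w_neq.
pose D := [set i : 'I_n'.+1 | tr q m (del * w ^+ i) != 0].
pose H := [set i : 'I_n'.+1 | ((q ^ f).+1 %| i)%N].
pose K := (q ^ m.-2)%N.
have dE : (q * K = q ^ m.-1)%N by rewrite /K -expnS prednK // -ltnS prednK.
(* The intersection of two distinct hyperplanes has K elements. *)
have Qm : (q ^ m = q * (q * K))%N by rewrite /K -!expnS prednK ?prednK // -ltnS prednK.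
have tr_inv (u c x : F) : c \in Fq F q -> c != 0 -> (tr q m (u * (c * x)) == 0) = (tr q m (u * x) == 0).
  by move=> Fc c_neq0; rewrite mulrCA (trZ _ _ Fc) mulf_eq0 (negbTE c_neq0).
have card1 (u : F) : u != 0 -> #|[set x | tr q m (u * x) == 0]| = (q * K)%N.
  move=> u_neq0; apply/eqP; rewrite -(eqn_pmul2l q_gt0) -Qm.
  by rewrite (card_ker_trM q_gt1 m_gt0 cardF frobD).
have q1_gt0 : (0 < q.-1)%N by rewrite -ltnS prednK.
apply: (@etf_of_fine_difference_set R _ D H (K * q.-1)).
- move=> g g_neq0; pose u := del * w ^+ g.
  have u_neq0 : u != 0 by rewrite mulf_neq0 ?(prim_neq0 w_prim).
  pose P (x : F) := (tr q m (del * x) != 0) && (tr q m (u * x) != 0).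
  have -> : [set y in D | y + g \in D] = [set j : 'I_n'.+1 | P (w ^+ j)].
    apply/setP=> y; rewrite !inE /P; congr (_ && _).
    by rewrite (tr_prim_mod q_gt1 w_prim r_def) /u -mulrA -exprD addnC.
  apply/eqP; rewrite -(eqn_pmul2l q1_gt0) -(card_projective q_gt1 cardF w_prim r_def); last first.
    by move=> c x Fc c_neq0; rewrite /P !tr_inv.
  pose A (u' : F) := [set x | tr q m (u' * x) == 0].
  have -> : [set x | (x != 0) && P x] = ~: (A del :|: A u).
    apply/setP=> x; rewrite !inE negb_or /P; case: eqP => [->|//].
    by rewrite mulr0 (tr0 _ frobD) eqxx.
  have cardI : #|A del :&: A u| = K.
    have F0 : 0 \in Fq F q by rewrite (Fq0 q_gt1 m_gt0 cardF frobD).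
    have uv : u / del \notin Fq F q.
      rewrite /u mulrAC mulfV // mul1r (prim_Fq q_gt1 w_prim r_def).
      by rewrite gtnNdvd // lt0n.
    have := card_fiber_trM2 q_gt1 m_gt0 cardF frobD del_neq0 uv F0 F0.
    rewrite Qm mulnA => /eqP; rewrite eqn_pmul2l ?muln_gt0 ?q_gt0 // => /eqP <-.
    by apply: eq_card => x; rewrite !inE.
  have := cardsUI (A del) (A u); rewrite cardI !card1 // => cardU.
  have := cardsC (A del :|: A u); rewrite cardF Qm => cardC.
  exact/eqP/(two_nonkernels_count q_gt0 cardU cardC).
- by rewrite inE dvdn0.
- have n_dvd : ((q ^ f).+1 %| n'.+1)%N by rewrite -n_def dvdn_mull.
  have dvd_mod a : ((q ^ f).+1 %| a %% n'.+1)%N = ((q ^ f).+1 %| a)%N.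
    by rewrite {2}(divn_eq a n'.+1) dvdn_addr // dvdn_mull.
  by move=> x y; rewrite !inE /= => Hx Hy; rewrite dvd_mod dvdn_addr // dvd_mod dvdn_sub.
- rewrite -setI_eq0; apply/eqP/setP=> i; rewrite !inE; apply/negP=> /andP[/dvdnP[j def_i]].
  rewrite del_ker ?eqxx // def_i -exprM.
  have -> : (j * (q ^ f).+1 * q ^ f = j * (q ^ f).+1 + (q ^ m).-1 * j)%N.
    by rewrite /m expnD; case: (q ^ f)%N Qf_gt0 => // Q _; rewrite [(Q.+1 * Q.+1)%N]mulSn addSn /=; lia.
  by rewrite exprD [X in _ * X]exprM (prim_expr_order w_prim) expr1n mulr1.
- by rewrite card_ord.
- apply/eqP; rewrite -(eqn_pmul2l q1_gt0) -dE.
  have <- : #|[set x | (x != 0) && (tr q m (del * x) != 0)]| = (q.-1 * #|D|)%N.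
    apply: (card_projective q_gt1 cardF w_prim r_def (P := fun x => tr q m (del * x) != 0)).
    by move=> c x Fc c_neq0; rewrite tr_inv.
  have -> : [set x | (x != 0) && (tr q m (del * x) != 0)] = ~: [set x | tr q m (del * x) == 0].
    by apply/setP=> x; rewrite !inE; case: eqP => [->|//]; rewrite mulr0 (tr0 _ frobD) eqxx.
  apply/eqP/(nonkernel_count q_gt0); rewrite -Qm -cardF -(card1 del) //; exact: cardsC.
- exact: card_multiples n_def.
- exact: n_def.
- by rewrite expn_gt0 q_gt0.
by rewrite -dE -[((q ^ f) ^ 2)%N]expnM muln2 -addnn -/m Qm singer_welch.
Qed.

(** * McFarland difference sets *)

Lemma card_slices (A B : finType) (P : A -> B -> bool) :
  #|[set z : A * B | P z.1 z.2]| = (\sum_(a : A) #|[set b | P a b]|)%N.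
Proof.
rewrite -sum1_card (eq_bigr (fun a => \sum_(b | P a b) 1)%N) => [|a _].
  by rewrite pair_big_dep /=; apply: eq_bigl => z; rewrite inE.
by rewrite -sum1_card; apply: eq_bigl => b; rewrite inE.
Qed.

Lemma projective_count_pred (q K r c : nat) :
  (0 < q -> 0 < K -> r * q.-1 = (q * (q * K)).-1 -> q.-1 * c + 1 = q * K -> 0 < q.-1 ->
   r.-1 = q * c)%N.
Proof.
case: q => // p _ K_gt0 /= r_def c_def p_gt0.
have r_eq : (r * p = (p.+1 * c).+1 * p)%N by rewrite r_def -c_def; lia.
by move/eqP: r_eq; rewrite eqn_pmul2r // => /eqP->.
Qed.

Lemma mcfarland_welch (q K r : nat) :
  (0 < q -> 0 < r -> r * q.-1 = (q * (q * K)).-1 -> 0 < K ->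
   r ^ 2 * (q * K * r) = (q * K * r) ^ 2 + r ^ 2 * (r.-1 * K))%N.
Proof.
move=> q_gt0 r_gt0 r_def K_gt0.
have qr : (q * r = q * (q * K) + r.-1)%N.
  case: q q_gt0 r_def => // p _ /=; case: r r_gt0 => // r _ /=; lia.
have -> : (r ^ 2 * (q * K * r) = r ^ 2 * K * (q * r))%N by lia.
by rewrite qr; lia.
Qed.

(** The slice of index i > 0 is the kernel of x |-> tr (w^(i-1) * x), and these
    are all the hyperplanes. A shift (k, x) with k nonzero matches r - 1 pairs of
    distinct hyperplanes, and each pair meets, after translation by x, in
    q^(e-1) points. A shift (0, x) preserves the hyperplanes that contain x and
    moves the others off themselves; there are (q^e - 1) / (q - 1) of the former,
    each with q^e points. Both counts equal (r - 1) * q^(e-1). *)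
Lemma mcfarland_etf (R : realType) (q e r : nat) :
  prime_power q -> (0 < e)%N -> (r * q.-1 = (q ^ e.+1).-1)%N ->
  harmonic_simplex_etf R (q ^ e * r) (q ^ e.+1 * r.+1) (q ^ e.+1) r.
Proof.
move=> q_pp e_gt0 r_def.
have q_gt1 := prime_power_gt1 q_pp; have q_gt0 := ltnW q_gt1.
set m := e.+1 in r_def *; have m_gt0 : (0 < m)%N by [].
have q1_gt0 : (0 < q.-1)%N by rewrite -ltnS prednK.
pose K := (q ^ e.-1)%N; have K_gt0 : (0 < K)%N by rewrite expn_gt0 q_gt0.
have qK : (q * K = q ^ e)%N by rewrite /K -expnS prednK.
have Qm : (q ^ m = q * (q * K))%N by rewrite qK -expnS.
have r_gt0 : (0 < r)%N.
  case: (posnP r) r_def => // ->; rewrite mul0n => Q0.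
  have : (q ^ 1 <= q ^ m)%N by rewrite leq_exp2l.
  by rewrite expn1; lia.
have [F cardF frobD] := finite_field_exists q_pp m_gt0.
have [w w_prim] := primitive_element_exists q_gt1 m_gt0 cardF.
pose P (i : 'I_r.+1) (h : F) := (i != 0) && (tr q m (w ^+ i.-1 * h) == 0).
pose D := [set z : 'I_r.+1 * F | P z.1 z.2].
pose H := [set z : 'I_r.+1 * F | z.1 == 0].
have tr_inv (u c x : F) : c \in Fq F q -> c != 0 -> (tr q m (c * x * u) == 0) = (tr q m (x * u) == 0).
  by move=> Fc c_neq0; rewrite -mulrA (trZ _ _ Fc) mulf_eq0 (negbTE c_neq0).
have card1 (u : F) : u != 0 -> #|[set x | tr q m (u * x) == 0]| = (q * K)%N.
  move=> u_neq0; apply/eqP; rewrite -(eqn_pmul2l q_gt0) -Qm.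
  by rewrite (card_ker_trM q_gt1 m_gt0 cardF frobD).
have w_neq0 i : w ^+ i != 0 by apply: (prim_neq0 w_prim).
apply: (@etf_of_fine_difference_set R _ D H (r.-1 * K)).
- move=> [k x] kx_neq0.
  have -> : [set y in D | y + (k, x) \in D] = [set z | P z.1 z.2 && P (z.1 + k) (z.2 + x)].
    by apply/setP=> y; rewrite !inE.
  rewrite (card_slices (fun i h => P i h && P (i + k) (h + x))).
  have [k0 | k_neq0] := eqVneq k 0.
    have x_neq0 : x != 0 by move: kx_neq0; rewrite k0; apply: contraNneq => ->.
    (* c is the number of hyperplanes that contain x. *)
    pose c := #|[set j : 'I_r | tr q m (w ^+ j * x) == 0]|.
    have c_def : (q.-1 * c + 1 = q * K)%N.
      rewrite -(card_projective q_gt1 cardF w_prim r_def (P := fun y => tr q m (y * x) == 0)).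
        rewrite -(card1 x) // [RHS](cardsD1 0) inE mulr0 (tr0 _ frobD) eqxx addnC.
        by congr (_ + _)%N; apply: eq_card => y; rewrite !inE [y * x]mulrC.
      by move=> c' y Fc c_neq0; rewrite tr_inv.
    (* Splitting off the slice 0 turns the exponent i.-1 into an index j < r. *)
    rewrite k0 big_ord_recl eq_card0 ?add0n => [|h]; last by rewrite !inE.
    rewrite (eq_bigr (fun j : 'I_r => if tr q m (w ^+ j * x)%R == 0%R then q * K else 0)%N) => [|j _].
      rewrite -big_mkcond sum_nat_cond_const /= -/c (projective_count_pred (c := c) q_gt0 K_gt0) -?Qm //.
      lia.
    case: ifP => [/eqP trx | trx].
      rewrite -(card1 (w ^+ j)) //; apply: eq_card => h.
      by rewrite !inE /P addr0 mulrDr (trD _ frobD) trx addr0 andbb.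
    apply: eq_card0 => h; rewrite !inE /P addr0 mulrDr (trD _ frobD).
    apply/negP=> /andP[/andP[_ /eqP->] /andP[_]]; rewrite add0r lift0 /=.
    by rewrite trx.
  (* The slice i matters when neither i nor i + k is the empty slice 0. *)
  pose I0 : {set 'I_r.+1} := ~: [set 0; - k].
  rewrite (eq_bigr (fun i => if i \in I0 then K else 0)%N) => [|i _].
    rewrite -big_mkcond sum_nat_const cardsCs setCK card_ord cards2 eq_sym oppr_eq0 k_neq0.
    by rewrite subn2.
  rewrite !inE negb_or; case: ifP => [/andP[i_neq0 ik] | /negbT i_neq]; last first.
    apply: eq_card0 => h; rewrite !inE /P addr_eq0 addrC.
    by move: i_neq; rewrite negb_and => /orP[] /negbTE->; rewrite ?andbF.
  have ik_neq0 : i + k != 0 by rewrite addr_eq0.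
  have lt_r (j : 'I_r.+1) : j != 0 -> (j.-1 < r)%N.
    by case: j => -[|j] //= ltj _; rewrite -ltnS.
  have ratio : w ^+ (i + k)%R.-1 / w ^+ i.-1 \notin Fq F q.
    apply: (prim_ratio_Fq q_gt1 w_prim r_def); rewrite ?lt_r //.
    apply: contraNneq k_neq0 => /(congr1 S); rewrite !prednK ?lt0n // => eq_ik.
    by apply/eqP/(addrI i); rewrite addr0; apply: val_inj.
  have Ftr : - tr q m (w ^+ (i + k)%R.-1 * x) \in Fq F q.
    by rewrite -(trN _ frobD) (tr_Fq q_gt1 m_gt0 cardF frobD).
  have F0 : 0 \in Fq F q by rewrite (Fq0 q_gt1 m_gt0 cardF frobD).
  have := card_fiber_trM2 q_gt1 m_gt0 cardF frobD (w_neq0 i.-1) ratio F0 Ftr.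
  rewrite Qm mulnA => /eqP; rewrite eqn_pmul2l ?muln_gt0 ?q_gt0 // => /eqP <-.
  apply: eq_card => h; rewrite !inE /P i_neq0 ik_neq0 /=.
  by rewrite mulrDr (trD _ frobD) addr_eq0.
- by rewrite inE.
- by move=> [i h] [j h'] /[!inE] /= /eqP-> /eqP->; rewrite subrr.
- rewrite -setI_eq0; apply/eqP/setP=> z; rewrite !inE /P.
  by case: (z.1 == 0).
- by rewrite card_prod card_ord cardF mulnC.
- rewrite card_slices big_ord_recl eq_card0 ?add0n => [|h]; last by rewrite !inE.
  rewrite (eq_bigr (fun=> q * K)%N) => [|j _]; first by rewrite sum_nat_const card_ord qK mulnC.
  by rewrite -(card1 (w ^+ j)) //; apply: eq_card => h; rewrite !inE.
- have -> : H = setX [set 0] setT by apply/setP=> -[i h]; rewrite !inE andbT.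
  by rewrite cardsX cards1 cardsT cardF mul1n.
- by [].
- by rewrite muln_gt0 expn_gt0 q_gt0.
by rewrite -qK mcfarland_welch // -Qm.
Qed.

(** * Quadratic characters and twin prime powers *)

Section QuadraticCharacter.
Variable F : finFieldType.
Hypothesis F_odd : odd #|F|.
Implicit Types x y g : F.
Local Notation N := #|F|.

(** Euler's criterion is taken as the definition of the quadratic character; it
    makes multiplicativity and the value at -1 immediate. *)
Definition quadchar x : int :=
  if x == 0 then 0 else if x ^+ N./2 == 1 then 1 else -1.

Let N_half : N = (N./2.*2).+1.
Proof. by rewrite -[LHS]odd_double_half F_odd. Qed.

Let half_gt0 : (0 < N./2)%N.
Proof. by have := finNzRing_gt1 F; rewrite {1}N_half; case: (N./2). Qed.

Lemma oppr1_neq1 : -1 != 1 :> F.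
Proof.
rewrite -subr_eq0 -opprD oppr_eq0; apply/eqP=> two0.
have := mulrn_card (1 : F); rewrite N_half mulrS -addnn mulrnDr -mulrnDl two0 mul0rn addr0.
by apply/eqP/oner_neq0.
Qed.

Lemma half_power_eq x : x != 0 -> (x ^+ N./2 == 1) || (x ^+ N./2 == -1).
Proof.
move=> x_neq0; rewrite -sqrf_eq1 -exprM muln2; apply/eqP/(mulfI x_neq0).
by rewrite -exprS -N_half expf_card mulr1.
Qed.

Lemma quadcharE x : x != 0 -> x ^+ N./2 = (quadchar x)%:~R.
Proof.
move=> x_neq0; rewrite /quadchar (negbTE x_neq0).
case/orP: (half_power_eq x_neq0) => /eqP->; first by rewrite eqxx rmorph1.
by rewrite (negbTE oppr1_neq1) rmorphN1.
Qed.

Lemma quadchar0 : quadchar 0 = 0. Proof. by rewrite /quadchar eqxx. Qed.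

Lemma quadchar_cases x : x != 0 -> quadchar x = 1 \/ quadchar x = -1.
Proof. by rewrite /quadchar => /negbTE->; case: ifP; [left | right]. Qed.

Lemma quadcharM x y : quadchar (x * y) = quadchar x * quadchar y.
Proof.
have [-> | x_neq0] := eqVneq x 0; first by rewrite mul0r quadchar0 mul0r.
have [-> | y_neq0] := eqVneq y 0; first by rewrite mulr0 quadchar0 mulr0.
have := quadcharE (mulf_neq0 x_neq0 y_neq0).
rewrite exprMn !quadcharE // -intrM.
have m1 : (-1 : int)%:~R = -1 :> F by rewrite rmorphN1.
have := oppr1_neq1.
case: (quadchar_cases x_neq0) => ->; case: (quadchar_cases y_neq0) => ->;
  case: (quadchar_cases (mulf_neq0 x_neq0 y_neq0)) => -> neq //= /eqP;
  by rewrite ?mulN1r ?mulrN1 ?opprK ?mulr1 ?m1 ?[_ == -1]eq_sym (negbTE neq).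
Qed.

Lemma quadchar_sqr x : quadchar x * quadchar x = (x != 0)%:R.
Proof.
have [-> | x_neq0] := eqVneq x 0; first by rewrite quadchar0.
by case: (quadchar_cases x_neq0) => ->.
Qed.

Lemma quadchar1 : quadchar 1 = 1.
Proof. by rewrite /quadchar oner_eq0 expr1n eqxx. Qed.

Lemma quadcharN1 : quadchar (-1) = (-1) ^+ N./2.
Proof.
rewrite /quadchar oppr_eq0 oner_eq0 -(signr_odd F) -(signr_odd int).
by case: (odd _) => /=; rewrite ?expr0 ?eqxx // !expr1 (negbTE oppr1_neq1).
Qed.

(** The value -1 is attained, since 'X^(N./2) - 1 has too few roots; multiplying by
    an element of character -1 changes the sign of the sum. *)
Lemma sum_quadchar : \sum_x quadchar x = 0.
Proof.
have [a a_neq0 chi_a] : exists2 a, a != 0 & quadchar a = -1.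
  case: (pickP (fun a => (a != 0) && (quadchar a == -1))) => [a /andP[? /eqP]|no_a].
    by exists a.
  have p_size : size ('X^(N./2) - 1 : {poly F}) = (N./2).+1 by rewrite size_XnsubC.
  have : (#|[set~ (0%R : F)]| < size ('X^(N./2) - 1 : {poly F})%R)%N.
    apply: card_roots_le => [|x]; first by rewrite -size_poly_gt0 p_size.
    rewrite !inE => x_neq0; rewrite rootE !hornerE subr_eq0.
    by have := no_a x; rewrite /quadchar x_neq0 (negbTE x_neq0); case: (_ ^+ _ == 1).
  by rewrite p_size cardsC1 {1}N_half /=; move: half_gt0; lia.
have /eqP : \sum_x quadchar x = - \sum_x quadchar x.
  rewrite {1}(reindex_inj (mulfI a_neq0)) -sumrN; apply: eq_bigr => x _.
  by rewrite quadcharM chi_a mulN1r.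
by rewrite -addr_eq0 -mulr2n mulrn_eq0 => /eqP.
Qed.

(** For nonzero x, the product of the characters of x and x + g is the character of
    1 + g / x, which takes every value except 1 as x varies when g is nonzero. *)
Lemma quadchar_autocorrelation g :
  \sum_x quadchar x * quadchar (x + g) = N%:R *+ (g == 0) - 1.
Proof.
have sum_neq0 (f : F -> int) : \sum_(x | x != 0) f x = \sum_x f x - f 0.
  by rewrite [in RHS](bigD1 0) //= addrAC subrr add0r.
have [-> | g_neq0] := eqVneq g 0.
  rewrite (eq_bigr (fun x => 1 - (x == 0)%:R)) => [|x _].
    by rewrite sumrB sumr_const [X in _ - X](bigD1 0) //= eqxx big1 ?addr0 // => x /negbTE->.
  by rewrite addr0 quadchar_sqr; case: eqP => _; rewrite ?subrr ?subr0.
rewrite mulr0n sub0r (bigD1 0) //= quadchar0 mul0r add0r.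
rewrite (eq_bigr (fun x => quadchar (1 + g / x))) => [|x x_neq0].
  rewrite (reindex_inj (inj_comp (mulfI g_neq0) invr_inj)) /=.
  rewrite (eq_big (fun x => x != 0) (fun x => quadchar (1 + x))) => [|x|x x_neq0].
  - rewrite sum_neq0 addr0 quadchar1 (_ : \sum_x _ = 0) ?sub0r //.
    by rewrite -[RHS]sum_quadchar [RHS](reindex_inj (addrI 1)).
  - by rewrite mulf_eq0 invr_eq0 (negbTE g_neq0).
  by rewrite invfM invrK mulrA divff ?mul1r.
have -> : x + g = x * (1 + g / x) by rewrite mulrDr mulr1 mulrCA divff // mulr1.
by rewrite quadcharM mulrA quadchar_sqr x_neq0 mul1r.
Qed.

End QuadraticCharacter.

(** The two weights below are the one-variable factors of the twin prime power set;
    their correlations with any function only involve its sum and one value. *)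
Section Indicators.
Variable V : finZmodType.
Implicit Types (g x : V) (f : V -> int).

Definition one_plus_delta x : int := 1 + (x == 0)%:R.
Definition one_minus_delta x : int := 1 - (x == 0)%:R.

Lemma sum_shift f g : \sum_x f (x + g) = \sum_x f x.
Proof. by rewrite [RHS](reindex_inj (addIr g)). Qed.

Lemma sum_delta f : \sum_x (x == 0)%:R * f x = f 0.
Proof.
by rewrite (bigD1 0) //= eqxx mul1r big1 ?addr0 // => x /negbTE->; rewrite mul0r.
Qed.

Lemma sum_one_plus_deltaM f : \sum_x one_plus_delta x * f x = \sum_x f x + f 0.
Proof.
by under eq_bigr do rewrite mulrDl mul1r; rewrite big_split /= sum_delta.
Qed.

Lemma sum_one_minus_deltaM f : \sum_x one_minus_delta x * f x = \sum_x f x - f 0.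
Proof.
by under eq_bigr do rewrite mulrBl mul1r; rewrite sumrB sum_delta.
Qed.

Lemma sum_one_plus_delta : \sum_x one_plus_delta x = #|V|%:R + 1.
Proof.
by under eq_bigr do rewrite -[one_plus_delta _]mulr1; rewrite sum_one_plus_deltaM sumr_const.
Qed.

Lemma sum_one_minus_delta : \sum_x one_minus_delta x = #|V|%:R - 1.
Proof.
by under eq_bigr do rewrite -[one_minus_delta _]mulr1; rewrite sum_one_minus_deltaM sumr_const.
Qed.

Lemma sum_one_plus_delta_shift f g : \sum_x f x * one_plus_delta (x + g) = \sum_x f x + f (- g).
Proof.
rewrite -[LHS](sum_shift _ (- g)) (eq_bigr (fun x => one_plus_delta x * f (x - g))) => [|x _].
  by rewrite sum_one_plus_deltaM sum_shift sub0r.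
by rewrite subrK mulrC.
Qed.

Lemma sum_one_minus_delta_shift f g : \sum_x f x * one_minus_delta (x + g) = \sum_x f x - f (- g).
Proof.
rewrite -[LHS](sum_shift _ (- g)) (eq_bigr (fun x => one_minus_delta x * f (x - g))) => [|x _].
  by rewrite sum_one_minus_deltaM sum_shift sub0r.
by rewrite subrK mulrC.
Qed.
End Indicators.

Section TwinPrimePower.
Variables (E F : finFieldType) (k : nat).
Hypotheses (k_gt0 : (0 < k)%N) (cardE : #|E| = (2 * k - 1)%N) (cardF : #|F| = (2 * k + 1)%N).
Local Notation chiE := (@quadchar E).
Local Notation chiF := (@quadchar F).

Definition twin_set := [set z : E * F |
  (z.2 != 0) && ((z.1 == 0) || (chiE z.1 * chiF z.2 == -1))].

Let E_odd : odd #|E|.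
Proof. by rewrite cardE oddB ?oddM // mul2n -addnn addn_gt0 k_gt0. Qed.
Let F_odd : odd #|F|. Proof. by rewrite cardF oddD oddM. Qed.

Definition twin_factors (z : E * F) : int := one_plus_delta z.1 * one_minus_delta z.2 - chiE z.1 * chiF z.2.

(** The reason for the weights one_plus_delta and one_minus_delta: the line x = 0,
    on which the characters vanish, must have weight 2, and the line y = 0 must
    have weight 0. *)
Lemma twin_factorsE z : twin_factors z = 2 * (z \in twin_set)%:R.
Proof.
rewrite /twin_factors inE /one_plus_delta /one_minus_delta.
have [-> | y_neq0] := eqVneq z.2 0; first by rewrite subrr !mulr0 quadchar0 mulr0 subrr.
have [-> | x_neq0] := eqVneq z.1 0; first by rewrite quadchar0 mul0r.
by case: (quadchar_cases x_neq0) => ->; case: (quadchar_cases y_neq0) => ->.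
Qed.

Lemma sum_prod (a : E -> int) (b : F -> int) :
  \sum_(z : E * F) a z.1 * b z.2 = (\sum_x a x) * (\sum_y b y).
Proof. by rewrite big_distrlr pair_big. Qed.

Lemma card_twin_set : #|twin_set| = (2 * k ^ 2)%N.
Proof.
have : \sum_z twin_factors z = 2 * #|twin_set|%:R.
  rewrite (eq_bigr _ (fun z _ => twin_factorsE z)) -mulr_sumr -sum1_card natr_sum.
  by rewrite [in RHS]big_mkcond /=; congr (_ * _); apply: eq_bigr => z _; case: (z \in _).
rewrite sumrB !sum_prod sum_one_plus_delta sum_one_minus_delta !sum_quadchar // cardE cardF.
lia.
Qed.

(** One of q and q + 2 is 3 modulo 4 and the other is 1 modulo 4, so -1 is a square
    in exactly one of the two fields. *)
Lemma quadcharN_twin g h : chiE (- g) * chiF (- h) = - (chiE g * chiF h).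
Proof.
rewrite -[- g]mulN1r -[- h]mulN1r !quadcharM // mulrACA !quadcharN1 //.
have -> : (#|E|./2 = k.-1)%N by rewrite cardE; lia.
have -> : (#|F|./2 = k.-1.+1)%N by rewrite cardF; lia.
by rewrite -exprD addnS addnn exprS -signr_odd odd_double mulr1 mulN1r.
Qed.

(** The two mixed terms of the expansion cancel by [quadcharN_twin]. *)
Lemma twin_autocorrelation (g : E * F) : g != 0 ->
  #|[set z in twin_set | z + g \in twin_set]| = (k ^ 2)%N.
Proof.
case: g => g h gh_neq0.
have : \sum_z twin_factors z * twin_factors (z + (g, h)) =
    4 * #|[set z in twin_set | z + (g, h) \in twin_set]|%:R.
  rewrite -sum1_card natr_sum mulr_sumr [RHS]big_mkcond /=.
  apply: eq_bigr => z _; rewrite !twin_factorsE; move: twin_set => T; rewrite inE.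
  by case: (z \in _); case: (_ + _ \in _).
(* Each of the four products of the expansion separates the two variables. *)
have -> : \sum_z twin_factors z * twin_factors (z + (g, h)) =
    (\sum_x one_plus_delta x * one_plus_delta (x + g)) * (\sum_y one_minus_delta y * one_minus_delta (y + h))
    - (\sum_x one_plus_delta x * chiE (x + g)) * (\sum_y one_minus_delta y * chiF (y + h))
    - (\sum_x chiE x * one_plus_delta (x + g)) * (\sum_y chiF y * one_minus_delta (y + h))
    + (\sum_x chiE x * chiE (x + g)) * (\sum_y chiF y * chiF (y + h)).
  rewrite -!sum_prod -!sumrB -big_split; apply: eq_bigr => z _ /=.
  rewrite /twin_factors /=; ring.
rewrite sum_one_plus_deltaM sum_one_minus_deltaM !sum_shift !add0r sum_one_plus_delta sum_one_minus_delta.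
rewrite sum_one_plus_deltaM sum_one_minus_deltaM !sum_shift !add0r.
rewrite sum_one_plus_delta_shift sum_one_minus_delta_shift !sum_quadchar // !quadchar_autocorrelation //.
rewrite !add0r !mulrN quadcharN_twin !opprK addrK cardE cardF /one_plus_delta /one_minus_delta.
have : ~~ ((g == 0) && (h == 0)) by apply: contra gh_neq0 => /andP[/eqP-> /eqP->].
case: (g == 0); case: (h == 0) => //= _; rewrite ?mulr0n ?mulr1n; lia.
Qed.

Lemma twin_prime_power_etf (R : realType) :
  harmonic_simplex_etf R (2 * k ^ 2) ((2 * k - 1) * (2 * k + 1)) (2 * k - 1) (2 * k).
Proof.
pose H := [set z : E * F | z.2 == 0].
apply: (@etf_of_fine_difference_set R _ twin_set H (k ^ 2)).
- exact: twin_autocorrelation.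
- by rewrite inE.
- by move=> [x y] [x' y'] /[!inE] /= /eqP-> /eqP->; rewrite subrr.
- by rewrite -setI_eq0; apply/eqP/setP=> z; rewrite !inE; case: (z.2 == 0).
- by rewrite card_prod cardE cardF.
- exact: card_twin_set.
- have -> : H = setX setT [set 0] by apply/setP=> -[x y]; rewrite !inE.
  by rewrite cardsX cards1 cardsT cardE muln1.
- by rewrite addn1.
- by rewrite muln_gt0 expn_gt0 k_gt0.
lia.
Qed.

End TwinPrimePower.

(** * The three families *)

Theorem theorem7p5 (R : realType) (q d n v s : nat) :
  prime_power q ->
  [\/ exists f : nat,
        [/\ (2 <= f)%N,
            d = (q ^ (2 * f - 1))%N,
            n = ((q ^ (2 * f) - 1) %/ (q - 1))%N,
            v = ((q ^ f - 1) %/ (q - 1))%N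
          & s = (q ^ f)%N],
      exists e : nat,
        [/\ (1 <= e)%N,
            d = (q ^ e * ((q ^ (e + 1) - 1) %/ (q - 1)))%N,
            n = (q ^ (e + 1) * (1 + (q ^ (e + 1) - 1) %/ (q - 1)))%N,
            v = (q ^ (e + 1))%N
          & s = ((q ^ (e + 1) - 1) %/ (q - 1))%N]
    | [/\ prime_power (q + 2) /\ odd (q + 2),
          d = ((q + 1) ^ 2 %/ 2)%N,
          n = (q * (q + 2))%N,
          v = q
        & s = (q + 1)%N]] ->
  exists (G : finZmodType) (D : {set G}),
    [/\ difference_set D,
        #|G| = n /\ #|{: pontryagin_dual G R[i]}| = n,
        #|D| = d,
        is_etf fullv (harmonic R[i] D)
      & disjoint_union_of_simplices v s (harmonic R[i] D)].
Proof.
move=> q_pp params; rewrite -/(harmonic_simplex_etf R d n v s).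
have q_gt1 := prime_power_gt1 q_pp.
have q1_gt0 : (0 < q.-1)%N by lia.
have geom e : ((q ^ e).-1 %/ q.-1 * q.-1 = (q ^ e).-1)%N by rewrite divnK ?dvdn_pred_predX.
case: params => [[f [f_ge2 -> -> -> ->]] | [e [e_ge1 -> -> -> ->]] | [[q2_pp q2_odd] -> -> -> ->]].
- (* n is recovered from n (q - 1) = (q^f - 1) (q^f + 1) by dividing back. *)
  rewrite mul2n -addnn !subn1; apply: singer_complement_etf => //; first exact: ltnW.
  rewrite -[LHS](mulnK _ q1_gt0) mulnAC geom expnD; congr (_ %/ _)%N.
  have : (0 < q ^ f)%N by rewrite expn_gt0 ltnW.
  by case: (q ^ f)%N => // Q _; rewrite mulSn addSn /=; lia.
- by rewrite addn1 add1n !subn1; apply: mcfarland_etf.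
have [E cardE _] := finite_field_exists q_pp (isT : 0 < 1)%N.
have [F cardF _] := finite_field_exists q2_pp (isT : 0 < 1)%N.
rewrite !expn1 in cardE cardF.
pose k := ((q + 1)./2)%N.
have qk : (q + 1 = 2 * k)%N by rewrite /k; lia.
have -> : ((q + 1) ^ 2 %/ 2 = 2 * k ^ 2)%N by rewrite qk; lia.
have -> : (q * (q + 2) = (2 * k - 1) * (2 * k + 1))%N by congr (_ * _)%N; lia.
rewrite qk (_ : q = 2 * k - 1)%N; last by lia.
by apply: (@twin_prime_power_etf E F); lia.
Qed.
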